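(* Let $d$ and $d_1$ be integers with $1 \leq d_1 \leq d/2$ and set $d_2=d-d_1$. Consider the irreducible curve $C : f=0$ of degree $d$ in $\mathbb{P}^2$ (over $\mathbb{C}$) given by $$f(x,y,z)= x^d+x^{d_2+1}y^{d_1-1}+y^{d-1}z.$$ Then the following holds. (1) The curve $C$ is nearly free with exponents $(d_1,d_2)$. (2) The curve $C$ is rational and has a unique cusp, which has a unique Puiseux pair, namely $(d-1,d)$.
   Context: Let $S=\mathbb{C}[x,y,z]$ with its standard grading. For a reduced curve $C:f=0$ of degree $d$ in $\mathbb{P}^2$, with partial derivatives $f_x,f_y,f_z$, let $AR(f)=\{(a,b,c)\in S^3 : af_x+bf_y+cf_z=0\}$ be the graded $S$-module of Jacobian syzygies; a homogeneous syzygy has degree $m$ if $a,b,c$ are homogeneous of degree $m$. The curve $C$ is nearly free with exponents $(d_1,d_2)$, $d_1\le d_2$, if $d_1+d_2=d$ and $AR(f)$ is minimally generated as a graded $S$-module by three homogeneous syzygies, of degrees $d_1, d_2, d_2$. A cusp is a unibranch (locally irreducible) singular point of a plane curve; having a unique cusp means that the singular locus of $C$ is a single point and $C$ is unibranch there. A cusp has the unique Puiseux pair $(p,q)$, with $p<q$ coprime, if its germ is topologically equivalent to the germ $u^p=v^q$ at the origin of $\mathbb{C}^2$.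
   Formalization: In (2), the claims of a unique cusp with Puiseux pair (d-1,d) are stated only for d ≥ 3: for d = 2, d_1 = 1 the curve is the smooth conic 2x^2+yz = 0, which has no singular point. *)

(* Defs.v *)
From HB Require Import structures.
From mathcomp Require Import all_boot all_order all_algebra.
From mathcomp Require Import complex mpoly.
From mathcomp Require Import classical_sets reals topology normedtype.

Set Implicit Arguments.
Unset Strict Implicit.
Unset Printing Implicit Defensive.

Import Order.TTheory GRing.Theory Num.Theory.
Import numFieldNormedType.Exports.

Local Open Scope classical_set_scope.
Local Open Scope ring_scope.

(* The definitions are stated over a numFieldType K because K then carries the
   topology given by its norm; they are used with K := R[i], R : realType. *)

Definition irreducible_elt (A : idomainType) (f : A) : Prop :=
  [/\ f != 0, f \isn't a GRing.unit &
      forall g h : A, f = g * h -> g \is a GRing.unit \/ h \is a GRing.unit].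

Definition squarefree_elt (A : idomainType) (f : A) : Prop :=
  forall g h : A, f = g ^+ 2 * h -> g \is a GRing.unit.

Definition divides (A : idomainType) (f p : A) : Prop :=
  exists h : A, p = h * f.

Definition reduced_curve (K : numFieldType) (d : nat) (f : {mpoly K[3]}) : Prop :=
  [/\ (0 < d)%N, f != 0, f \is d.-homog & squarefree_elt f].

Definition AR (K : numFieldType) (f : {mpoly K[3]}) : set 'rV[{mpoly K[3]}]_3 :=
  [set s | \sum_(i < 3) s 0 i * f^`M(i) = 0].

Definition homog_triple (K : numFieldType) (m : nat) (s : 'rV[{mpoly K[3]}]_3)
    : Prop :=
  forall i : 'I_3, s 0 i \is m.-homog.

Definition generates (A : comNzRingType) (n k : nat) (M : set 'rV[A]_n)
    (g : 'I_k -> 'rV[A]_n) (D : {set 'I_k}) : Prop :=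
  M = [set s | exists c : 'I_k -> A, s = \sum_(j in D) c j *: g j].

Definition minimally_generates (A : comNzRingType) (n k : nat)
    (M : set 'rV[A]_n) (g : 'I_k -> 'rV[A]_n) : Prop :=
  generates M g [set: 'I_k]%SET /\
  forall D : {set 'I_k}, D \proper [set: 'I_k]%SET -> ~ generates M g D.

Definition nearly_free (K : numFieldType) (d d1 d2 : nat) (f : {mpoly K[3]})
    : Prop :=
  [/\ reduced_curve d f, (d1 <= d2)%N, (d1 + d2)%N = d &
      exists g : 'I_3 -> 'rV[{mpoly K[3]}]_3,
        (forall j : 'I_3, homog_triple (tnth [tuple d1; d2; d2] j) (g j)) /\
        minimally_generates (AR f) g].

(* A birational equivalence between P^1 and the curve f = 0, given by
   a = (a_0 : a_1 : a_2) : P^1 --> C and g = (g_0 : g_1) : C --> P^1.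
   Both maps and both composites are required to be defined generically; on C
   this means that some component is nonzero modulo f. *)
Definition birational_to_P1 (K : numFieldType) (f : {mpoly K[3]}) : Prop :=
  exists (e m : nat) (a : 3.-tuple {mpoly K[2]}) (g : 2.-tuple {mpoly K[3]}),
    [/\ (forall i : 'I_3, tnth a i \is e.-homog) /\
        (forall j : 'I_2, tnth g j \is m.-homog),
        (exists i : 'I_3, tnth a i != 0) /\ f \mPo a = 0,
        exists j : 'I_2, ~ divides f (tnth g j),
        (exists j : 'I_2, tnth g j \mPo a != 0) /\
        (forall i j : 'I_2,
           'X_i * (tnth g j \mPo a) = 'X_j * (tnth g i \mPo a)) &
        (exists i : 'I_3, ~ divides f (tnth a i \mPo g)) /\
        (forall i j : 'I_3,
           divides f ('X_i * (tnth a j \mPo g) - 'X_j * (tnth a i \mPo g)))].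

Definition rational_curve (K : numFieldType) (f : {mpoly K[3]}) : Prop :=
  irreducible_elt f /\ birational_to_P1 f.

(* Points of P^2 are given by nonzero vectors of homogeneous coordinates. *)
Definition singular_at (K : numFieldType) (f : {mpoly K[3]}) (v : 'rV[K]_3)
    : Prop :=
  f.@[v 0] = 0 /\ forall i : 'I_3, (f^`M(i)).@[v 0] = 0.

(* Equation of the curve in the affine coordinates (s, t) of the chart x_i <> 0
   centred at v (where v_i <> 0), in which (s, t) stands for the point
   v + s e_j + t e_k, with j < k the two indices other than i. *)
Definition local_eq (K : numFieldType) (f : {mpoly K[3]}) (v : 'rV[K]_3)
    (i : 'I_3) : {mpoly K[2]} :=
  f \mPo [tuple (v 0 k)%:MP +
                (if unlift i k is Some l then 'X_l else 0) | k < 3].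

(* The ring C{s,t} of convergent power series: a i j is the coefficient of
   s^i t^j. *)
Definition series2 (K : numFieldType) : Type := nat -> nat -> K.

Definition convergent (K : numFieldType) (a : series2 K) : Prop :=
  exists r M : K, 0 < r /\
    forall N : nat, \sum_(i < N) \sum_(j < N) `|a i j| * r ^+ (i + j) <= M.

Definition mul_series (K : numFieldType) (a b : series2 K) : series2 K :=
  fun i j => \sum_(k < i.+1) \sum_(l < j.+1) a k l * b (i - k)%N (j - l)%N.

Definition one_series (K : numFieldType) : series2 K :=
  fun i j => ((i == 0%N) && (j == 0%N))%:R.

Definition unit_series (K : numFieldType) (a : series2 K) : Prop :=
  exists b : series2 K, convergent b /\ mul_series a b =2 one_series K.

Definition irreducible_series (K : numFieldType) (a : series2 K) : Prop :=
  [/\ convergent a, exists i j, a i j != 0, ~ unit_series a &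
      forall b c : series2 K, convergent b -> convergent c ->
        a =2 mul_series b c -> unit_series b \/ unit_series c].

Definition series_of_mpoly (K : numFieldType) (F : {mpoly K[2]}) : series2 K :=
  fun i j => F@_[multinom [tuple i; j]].

Definition unibranch_at (K : numFieldType) (f : {mpoly K[3]}) (v : 'rV[K]_3)
    : Prop :=
  forall i : 'I_3, v 0 i != 0 ->
    irreducible_series (series_of_mpoly (local_eq f v i)).

Definition zero_set (K : numFieldType) (F : {mpoly K[2]}) : set (K * K) :=
  [set w | F.@[tnth [tuple w.1; w.2]] = 0].

(* Topological equivalence of the germs at the origin of A and B, as embedded
   germs: a homeomorphism h (with inverse k) between open neighbourhoods of the
   origin, fixing the origin and carrying A to B. *)
Definition top_equiv_germs (K : numFieldType) (A B : set (K * K)) : Prop :=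
  exists (U V : set (K * K)) (h k : K * K -> K * K),
    [/\ open_nbhs (0, 0) U /\ open_nbhs (0, 0) V,
        {within U, continuous h} /\ {within V, continuous k},
        (forall w, U w -> V (h w) /\ k (h w) = w) /\
        (forall w, V w -> U (k w) /\ h (k w) = w),
        h (0, 0) = (0, 0) &
        h @` (A `&` U) = B `&` V].

Definition has_unique_cusp_at (K : numFieldType) (f : {mpoly K[3]})
    (v : 'rV[K]_3) : Prop :=
  [/\ v != 0, singular_at f v,
      forall w : 'rV[K]_3, w != 0 -> singular_at f w ->
        exists c : K, c != 0 /\ w = c *: v &
      unibranch_at f v].

Definition unique_Puiseux_pair_at (K : numFieldType) (p q : nat)
    (f : {mpoly K[3]}) (v : 'rV[K]_3) : Prop :=
  [/\ (p < q)%N, coprime p q &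
      forall i : 'I_3, v 0 i != 0 ->
        top_equiv_germs (zero_set (local_eq f v i))
                        [set w : K * K | w.1 ^+ p = w.2 ^+ q]].

Definition curve_eq (K : numFieldType) (d d1 d2 : nat) : {mpoly K[3]} :=
  let x := 'X_(0 : 'I_3) in
  let y := 'X_(1 : 'I_3) in
  let z := 'X_(2 : 'I_3) in
  x ^+ d + x ^+ (d2 + 1) * y ^+ (d1 - 1) + y ^+ (d - 1) * z.

(* Main.v *)
(** In the chart z = 1 the curve reads
    s^d + s^(d2+1) t^(d1-1) + t^(d-1) = 0 at its only singular point.

    Syzygies.  Reducing a f_x + b f_y + c f_z = 0 successively modulo powers of
    y strips off factors until a pair (e, b'') remains, subject to the single
    congruence lambda x^m e + mu z b'' = 0 mod y, with constants lambda, mu and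
    m = d2 - d1 + 1; its solutions are generated by (mu z, - lambda x^m), (y, 0)
    and (0, y), which gives generators of degrees d2, d2 and d1.

    Unibranch.  The Newton polygon is a segment of coprime lengths d and d - 1,
    so its lowest weighted part cannot be split between two nonunits.

    Puiseux pair.  Multiplication by phi = - (1 + (t/s)^(d1-1)) preserves the
    lines through the origin and turns the equation into u^(d-1) = v^d.  It makes
    sense only near the tangent t = 0; extending phi to a continuous nonvanishing
    bounded function of the ratio (s : t) yields a homeomorphism of the plane. *)
Require Import Defs.
From mathcomp Require Import all_boot all_order all_algebra.
From mathcomp Require Import complex mpoly reals.
From mathcomp Require Import boolp classical_sets topology normedtype.
From mathcomp Require Import ring zify.
Import Order.TTheory GRing.Theory Num.Theory.
Import numFieldNormedType.Exports.
Set Implicit Arguments.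
Unset Strict Implicit.
Unset Printing Implicit Defensive.
Local Open Scope classical_set_scope.
Local Open Scope ring_scope.

(** * Polynomials and a distinguished variable *)

Lemma size_mul_eq2 (A : idomainType) (a b : {poly A}) :
  size (a * b) = 2%N -> size a = 1%N \/ size b = 1%N.
Proof.
move=> sab; have : a * b != 0 by rewrite -size_poly_eq0 sab.
rewrite mulf_eq0 => /norP[a0 b0]; move: sab; rewrite (size_mul a0 b0).
by move: a0 b0; rewrite -!size_poly_gt0; lia.
Qed.

Section Variables.
Variables (n : nat) (R : idomainType).
Implicit Types (i : 'I_n) (p q r : {mpoly R[n]}).

(** Reduction modulo [X_i], with residues kept in the same ring so that they can be recombined with
    multiples of [X_i]. *)
Definition subst0 i p : {mpoly R[n]} :=
  p \mPo [tuple if j == i then 0 else 'X_j | j < n].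

Lemma subst00 i : subst0 i 0 = 0.
Proof. exact: comp_mpoly0. Qed.

Lemma subst0D i : {morph subst0 i : p q / p + q}.
Proof. exact: comp_mpolyD. Qed.

Lemma subst0M i : {morph subst0 i : p q / p * q}.
Proof. exact: rmorphM. Qed.

Lemma subst0Xn i k : {morph subst0 i : p / p ^+ k}.
Proof. exact: rmorphXn. Qed.

Lemma subst0C i c : subst0 i c%:MP = c%:MP.
Proof. exact: comp_mpolyC. Qed.

Lemma subst0X i j : subst0 i 'X_j = if j == i then 0 else 'X_j.
Proof. by rewrite /subst0 comp_mpolyXU -tnth_nth tnth_mktuple. Qed.

(** Checked on monomials: one free of [X_i] is fixed by the substitution, any other is a multiple of
    [X_i]. *)
Lemma subst0_decomp i p : exists q, p = subst0 i p + 'X_i * q.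
Proof.
elim/mpolyind: p => [|c m p mp c0 [q pq]].
  by exists 0; rewrite /subst0 comp_mpoly0 mulr0 addr0.
suff [r mr] : exists r, 'X_[m] = subst0 i 'X_[m] + 'X_i * r.
  exists (c *: r + q).
  rewrite {1}mr {1}pq subst0D /subst0 comp_mpolyZ -/(subst0 _ _) mulrDr scalerDr.
  by rewrite -scalerAr addrACA.
have [mi0|mi0] := eqVneq (m i) 0%N.
  exists 0; rewrite mulr0 addr0 /subst0 comp_mpolyX {1}mpolyXE_id.
  apply: eq_bigr => j _; rewrite tnth_mktuple; case: eqVneq => // ->.
  by rewrite mi0.
exists 'X_[m - U_(i)].
have {1}-> : m = (U_(i) + (m - U_(i)))%MM.
  apply/mnmP => j; rewrite mnmDE mnmBE mnm1E.
  by case: eqVneq => [<-|_]; rewrite ?add0n ?subn0 // subnKC // lt0n.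
rewrite mpolyXD /subst0 comp_mpolyX (bigD1 i) //= tnth_mktuple eqxx.
by rewrite expr0n (negPf mi0) mul0r add0r.
Qed.

Lemma subst0_eq0 i p : subst0 i p = 0 -> exists q, p = 'X_i * q.
Proof. by have [q e] := subst0_decomp i p => p0; exists q; rewrite {1}e p0 add0r. Qed.

Lemma mpolyX_neq0 (m : 'X_{1..n}) : 'X_[m] != 0 :> {mpoly R[n]}.
Proof.
by apply/eqP => /mpolyP /(_ m); rewrite mcoeffX eqxx mcoeff0 => /eqP; rewrite oner_eq0.
Qed.

(** [X_i] is prime: modulo [X_i] the nonzero residue of [p] cancels, so the factors [X_i] move into
    [q] one at a time. *)
Lemma dvd_mul_expX i k p q r : subst0 i p != 0 -> p * q = 'X_i ^+ k * r ->
  exists q', q = 'X_i ^+ k * q'.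
Proof.
move=> p0; elim: k q r => [|k IHk] q r e; first by exists q; rewrite mul1r.
have [q1 q1E] : exists q1, q = 'X_i * q1.
  apply: subst0_eq0; apply: (mulfI p0); rewrite mulr0 -subst0M e exprS !subst0M.
  by rewrite subst0X eqxx !mul0r.
have [|q2 q2E] := IHk q1 r; last by exists q2; rewrite q1E q2E exprS mulrA.
apply: (mulfI (mpolyX_neq0 U_(i))).
by rewrite mulrCA -q1E e exprS mulrA.
Qed.

(** Exposes the degree in [X_i]. The coefficients stay in the full ring, so evaluating at [X_i]
    undoes the translation. *)
Definition univar i : {mpoly R[n]} -> {poly {mpoly R[n]}} :=
  mmap (polyC \o mpolyC n (R := R)) (fun j => if j == i then 'X else ('X_j)%:P).

Lemma univarM i : {morph univar i : p q / p * q}.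
Proof. exact: rmorphM. Qed.

Lemma univarDZ i c p q : univar i (c *: p + q) = c%:MP%:P * univar i p + univar i q.
Proof. by rewrite /univar mmapD mmapZ. Qed.

Lemma univarX i j : univar i 'X_j = if j == i then 'X else ('X_j)%:P.
Proof. by rewrite /univar mmapX mmap1U. Qed.

Lemma horner_univar i p : (univar i p).['X_i] = p.
Proof.
have mono m : (univar i 'X_[m]).['X_i] = 'X_[m].
  rewrite /univar mmapX [RHS]mpolyXE_id /mmap1 horner_prod.
  apply: eq_bigr => j _; rewrite horner_exp.
  by case: eqVneq => [->|_]; rewrite ?hornerX ?hornerC.
elim/mpolyind: p => [|c m p mp c0 IHp]; first by rewrite /univar mmap0 horner0.
rewrite univarDZ hornerD hornerM hornerC -mul_mpolyC.
exact: (congr2 +%R (congr1 ( *%R c%:MP) (mono m)) IHp).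
Qed.

(* A factorization of [P + Q X_i] puts [X_i] into one factor, so the other one
   divides both [P] and [Q]. *)
Lemma irreducible_linear i j k (P : {mpoly R[n]}) : i != j ->
  univar i P = P%:P -> subst0 j P != 0 ->
  forall g h, P + 'X_j ^+ k * 'X_i = g * h ->
  g \is a GRing.unit \/ h \is a GRing.unit.
Proof.
move=> ij PE P0 g h f_gh.
have fE : univar i (P + 'X_j ^+ k * 'X_i) = P%:P + ('X_j ^+ k)%:P * 'X.
  rewrite /univar rmorphD rmorphM rmorphXn /= -!/(univar _ _) PE !univarX eqxx.
  by rewrite eq_sym (negPf ij) polyC_exp.
have unit1 g' h' : P + 'X_j ^+ k * 'X_i = g' * h' -> size (univar i h') = 1%N ->
    h' \is a GRing.unit.
  move=> f_gh' /eqP /size_poly1P [c c0 hc].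
  have {}hc : univar i h' = h'%:P by rewrite -{2}(horner_univar i h') hc hornerC.
  have := fE; rewrite f_gh' univarM hc => gE.
  have gP : (univar i g')`_0 * h' = P.
    by have := congr1 (coefp 0) gE; rewrite /= coefMC coefD coefC coefMX addr0.
  have gQ : (univar i g')`_1 * h' = 'X_j ^+ k.
    by have := congr1 (coefp 1) gE; rewrite /= coefMC coefD coefC coefMX coefC add0r.
  (* As a divisor of [P], [h'] is nonzero modulo [X_j]; as it also divides [X_j ^+ k], its cofactor
     absorbs the whole power, which makes [h'] a unit. *)
  have h0 : subst0 j h' != 0.
    by apply: contra_neq P0; rewrite -gP subst0M => ->; rewrite mulr0.
  have [q qE] : exists q, (univar i g')`_1 = 'X_j ^+ k * q.
    by apply: (dvd_mul_expX (r := 1) h0); rewrite mulr1 mulrC.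
  apply/unitrP; exists q; rewrite [h' * q]mulrC.
  suff -> : q * h' = 1 by [].
  apply: (mulfI (expf_neq0 k (mpolyX_neq0 U_(j)))).
  by rewrite mulr1 mulrA -qE.
have sz : size (univar i g * univar i h) = 2%N.
  rewrite -univarM -f_gh fE addrC size_MXaddC polyC_eq0 size_polyC.
  by rewrite (negPf (expf_neq0 k (mpolyX_neq0 U_(j)))).
by case: (size_mul_eq2 sz) => s1; [left; exact: (unit1 h g (etrans f_gh (mulrC _ _)) s1) |
  right; exact: (unit1 g h f_gh s1)].
Qed.

End Variables.

Lemma irreducible_squarefree (A : idomainType) (f : A) :
  irreducible_elt f -> squarefree_elt f.
Proof.
case=> _ _ irr g h; rewrite expr2 -mulrA => /irr [//|].
by rewrite unitrM => /andP[].
Qed.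

(** * Jacobian syzygies *)

Section Homogeneity.
Variable K : numFieldType.

Lemma homogC n (c : K) : c%:MP \is [in K[n], 0.-homog].
Proof. by rewrite -[c%:MP]mulr1 mul_mpolyC rpredZ ?dhomog1. Qed.

Lemma homogX n (i : 'I_n) (d : nat) : 1%N = d -> 'X_i \is [in K[n], d.-homog].
Proof. by move=> <-; rewrite dhomogX /= mdeg1. Qed.

Lemma homogXn n (i : 'I_n) (k d : nat) :
  k = d -> 'X_i ^+ k \is [in K[n], d.-homog].
Proof. by move=> <-; rewrite -[X in X.-homog]mul1n dhomogMn // homogX. Qed.

Lemma homogM n (p q : {mpoly K[n]}) (d e h : nat) : p \is d.-homog -> q \is e.-homog ->
  (d + e)%N = h -> p * q \is h.-homog.
Proof. by move=> pd qe <-; exact: dhomogM. Qed.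

End Homogeneity.

Ltac homog_auto :=
  lazymatch goal with
  | |- is_true (in_mem ?p _) =>
    lazymatch p with
    | mpolyC _ _ => apply: homogC
    | mpolyX _ _ => apply: homogX; first [reflexivity | lia]
    | GRing.exp (mpolyX _ _) _ => apply: homogXn; first [reflexivity | lia]
    | GRing.exp _ 2 => rewrite expr2; homog_auto
    | GRing.mul _ _ =>
      eapply homogM; [homog_auto | homog_auto | first [reflexivity | lia]]
    | Algebra.opp _ => rewrite rpredN; homog_auto
    | Algebra.add _ _ => apply: rpredD; homog_auto
    end
  end.

Section Syzygies.
Variable K : numFieldType.

Local Notation S := {mpoly K[3]}.
Local Notation x := ('X_(0 : 'I_3) : S).
Local Notation y := ('X_(1 : 'I_3) : S).
Local Notation z := ('X_(2 : 'I_3) : S).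

Lemma forall_I3 (P : 'I_3 -> Prop) : P 0 -> P 1 -> P 2 -> forall i, P i.
Proof.
move=> P0 P1 P2 [[|[|[|//]]] i3].
- by rewrite (_ : Ordinal i3 = 0) //; apply: val_inj.
- by rewrite (_ : Ordinal i3 = 1) //; apply: val_inj.
- by rewrite (_ : Ordinal i3 = 2) //; apply: val_inj.
Qed.

Lemma sum_I3 (A : nmodType) (F : 'I_3 -> A) : \sum_(i < 3) F i = F 0 + F 1 + F 2.
Proof.
rewrite !big_ord_recl big_ord0 addr0 addrA.
by congr (F _ + F _ + F _); apply: val_inj.
Qed.

Definition row3 (A : Type) (a b c : A) : 'rV[A]_3 :=
  \row_(i < 3) tnth [tuple a; b; c] i.

Lemma row3_0 (A : Type) (a b c : A) : row3 a b c 0 0 = a.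
Proof. by rewrite /row3 mxE. Qed.

Lemma row3_1 (A : Type) (a b c : A) : row3 a b c 0 1 = b.
Proof. by rewrite /row3 mxE. Qed.

Lemma row3_2 (A : Type) (a b c : A) : row3 a b c 0 2 = c.
Proof. by rewrite /row3 mxE. Qed.

Definition row3E := (row3_0, row3_1, row3_2).

Lemma comb3E (A : nzRingType) (r0 r1 r2 : A) (s0 s1 s2 : 'rV[A]_3) i :
  (r0 *: s0 + r1 *: s1 + r2 *: s2) 0 i = r0 * s0 0 i + r1 * s1 0 i + r2 * s2 0 i.
Proof. by rewrite !mxE. Qed.

Lemma row3_eq (A : Type) (s : 'rV[A]_3) a b c :
  s 0 0 = a -> s 0 1 = b -> s 0 2 = c -> s = row3 a b c.
Proof.
by move=> sa sb sc; apply/rowP; apply: forall_I3; rewrite row3E.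
Qed.

Lemma tnth3_0 (A : Type) (a b c : A) : tnth [tuple a; b; c] 0 = a.
Proof. by []. Qed.

Lemma tnth3_1 (A : Type) (a b c : A) : tnth [tuple a; b; c] 1 = b.
Proof. by []. Qed.

Lemma tnth3_2 (A : Type) (a b c : A) : tnth [tuple a; b; c] 2 = c.
Proof. by []. Qed.

Definition tnth3E := (tnth3_0, tnth3_1, tnth3_2).

Lemma AR_row3 (f : S) a b c :
  AR f (row3 a b c) <-> a * f^`M(0) + b * f^`M(1) + c * f^`M(2) = 0.
Proof. by rewrite /AR /mkset /= sum_I3 !row3E. Qed.

Lemma AR_sum (f : S) (I : finType) (P : pred I) (c : I -> S) (g : I -> 'rV[S]_3) :
  (forall j, P j -> AR f (g j)) -> AR f (\sum_(j | P j) c j *: g j).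
Proof.
move=> gAR; rewrite /AR /mkset /=.
under eq_bigr => i _.
  rewrite summxE mulr_suml; under eq_bigr do rewrite mxE -mulrA.
  over.
rewrite exchange_big big1 //= => j Pj; rewrite -mulr_sumr.
by have := gAR j Pj; rewrite /AR /mkset /= => ->; rewrite mulr0.
Qed.

(* Minimality is tested by evaluating the generators at the points [P] and [Q]. *)
Lemma minimally_generates_row3 (f : S) (g : 'I_3 -> 'rV[S]_3) (P Q : 'I_3 -> K) :
  (forall j, AR f (g j)) ->
  (forall s, AR f s -> exists c : 'I_3 -> S, s = \sum_j c j *: g j) ->
  (g 0 0 0).@[P] = 0 -> (g 0 0 1).@[P] != 0 ->
  (g 1 0 0).@[P] = 0 -> (g 1 0 1).@[P] = 0 ->
  (g 2 0 0).@[P] != 0 ->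
  (g 0 0 1).@[Q] = 0 -> (g 1 0 1).@[Q] != 0 -> (g 2 0 1).@[Q] = 0 ->
  minimally_generates (AR f) g.
Proof.
move=> gAR gen g0a g0b g1a g1b g2a h0 h1 h2; split.
  rewrite /generates; apply/seteqP; split=> s /=.
    by move=> /gen [c ->]; exists c; apply: eq_bigl => j; rewrite inE.
  by case=> c ->; apply: AR_sum => j _; exact: gAR.
move=> D /properP[_ [j _ jD]] genD.
have : AR f (g j) by exact: gAR.
rewrite genD /= => -[c].
rewrite big_mkcond sum_I3 => gj.
(* Extending the coefficients by zero outside [D] turns the omitted generator into a combination
   whose own coefficient is zero. *)
pose e i := if i \in D then c i else 0.
have {}gj : g j = e 0 *: g 0 + e 1 *: g 1 + e 2 *: g 2.
  have eE i : (if i \in D then c i *: g i else 0) = e i *: g i.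
    by rewrite /e; case: ifP => // _; rewrite scale0r.
  by rewrite -!eE; exact: gj.
have ej : e j = 0 by rewrite /e (negPf jD).
have comp i v : (g j 0 i).@[v] = (e 0).@[v] * (g 0 0 i).@[v] +
    (e 1).@[v] * (g 1 0 i).@[v] + (e 2).@[v] * (g 2 0 i).@[v].
  rewrite -!mevalM -!mevalD; congr (_.@[v]).
  by rewrite {1}gj comb3E.
move: j jD ej gj comp; apply: forall_I3 => _ ej _ comp.
(* The first coordinate at [P] forces [e 2] to vanish there; then nothing is left to produce the
   second coordinate of [g 0]. *)
- have := comp 0 P; rewrite g0a g1a !mulr0 !add0r => /esym/eqP.
  rewrite mulf_eq0 (negPf g2a) orbF => /eqP e2.
  have := comp 1 P; rewrite ej meval0 g1b e2 !mul0r !mulr0 !addr0.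
  by move/eqP; rewrite (negPf g0b).
- have := comp 1 Q; rewrite h0 h2 ej meval0 !mulr0 !mul0r !addr0.
  by move/eqP; rewrite (negPf h1).
- have := comp 0 P; rewrite g0a g1a ej meval0 !mulr0 !mul0r !addr0.
  by move/eqP; rewrite (negPf g2a).
Qed.

Lemma mevalXn (n k : nat) (v : 'I_n -> K) (p : {mpoly K[n]}) :
  (p ^+ k).@[v] = p.@[v] ^+ k.
Proof. exact: rmorphXn. Qed.

Definition mevalRE := (mevalD, mevalN, mevalM, mevalXn, mevalC, mevalXU).

(** * Syzygies in the case d1 >= 2 *)

Section GeneralCase.
(** Here d1 = k + 2, d2 = k + l + 2 and d = 2k + l + 4, while [al], [be], [ga], [de] stand for d1 -
    1, d2 + 1, d - 1, d. Splitting the exponents makes every identity below polynomial in [x ^+ k],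
    [x ^+ l], [y ^+ k], [y ^+ l] and the variables. *)
Variables (k l : nat) (al be ga de : K).
Hypotheses (al0 : al != 0) (be0 : be != 0) (ga0 : ga != 0) (de0 : de != 0).
Let a_ : S := al%:MP.
Let b_ : S := be%:MP.
Let c_ : S := ga%:MP.
Let d_ : S := de%:MP.
Let fx : S := d_ * (x ^+ k * x ^+ k * x ^+ l * x ^+ 3) +
  b_ * (x ^+ k * x ^+ l * x ^+ 2 * (y ^+ k * y)).
Let fy : S := y ^+ k * (a_ * (x ^+ k * x ^+ l * x ^+ 3) +
  c_ * (y ^+ k * y ^+ l * y ^+ 2) * z).
Let fz : S := y ^+ k * y ^+ k * y ^+ l * y ^+ 3.

(** The three generators come from unwinding the reduction in [syzygy_gen]: up to constants,
    [gen_v], [gen_u], [gen_w] correspond to the pairs (e, b2) = (0, y), ([de ga] z, - [al be]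
    x^(l+1)), (y, 0). *)
Definition gen_v : 'rV[S]_3 :=
  row3 (- (a_ * x * (y ^+ k * y)))
       (d_ * (x ^+ k * x) * y + b_ * (y ^+ k * y ^+ 2))
       (- (d_ * c_ * (x ^+ k * x) * z) - b_ * c_ * (y ^+ k * y) * z).

Let G : S := d_ * c_ * z * (y ^+ l * y) + a_ * b_ * (x ^+ l * x ^+ 2).

Definition gen_u : 'rV[S]_3 :=
  row3 (a_ * y ^+ k * G)
       (- (d_ * x ^+ k * G) - a_ * b_ ^+ 2 * (y ^+ k * y) * (x ^+ l * x))
       ((d_ * c_) ^+ 2 * x ^+ k * z ^+ 2 * y ^+ l +
        a_ * b_ ^+ 2 * c_ * y ^+ k * (x ^+ l * x) * z).

Definition gen_w : 'rV[S]_3 :=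
  row3 (a_ * (y ^+ k * y ^+ l * y ^+ 2))
       (- (d_ * x ^+ k * (y ^+ l * y ^+ 2)))
       (- (a_ * b_ * (x ^+ k * x ^+ l * x ^+ 2)) +
        d_ * c_ * x ^+ k * z * (y ^+ l * y)).

Lemma mpolyC_neq0 (c : K) : c != 0 -> c%:MP != 0 :> S.
Proof. by rewrite mpolyC_eq0. Qed.

(** Turns a syzygy relation into a divisibility identity: the difference of the two sides is the
    vanishing combination. *)
Lemma eq_of_sub0 (A : zmodType) (u v w : A) : u - v = w -> w = 0 -> u = v.
Proof. by move=> uv w0; apply/eqP; rewrite -subr_eq0 uv w0. Qed.

Lemma subst0y_x j : subst0 (1 : 'I_3) (x ^+ j) = x ^+ j.
Proof. by rewrite subst0Xn subst0X. Qed.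

Lemma subst0y_x1 : subst0 (1 : 'I_3) x = x.
Proof. by rewrite subst0X. Qed.

Lemma subst0y_y1 : subst0 (1 : 'I_3) y = 0.
Proof. by rewrite subst0X. Qed.

Lemma subst0y_y j : (0 < j)%N -> subst0 (1 : 'I_3) (y ^+ j) = 0.
Proof. by case: j => // j _; rewrite subst0Xn subst0X eqxx expr0n. Qed.

Lemma X_neq0 (i : 'I_3) : 'X_i != 0 :> S.
Proof. exact: mpolyX_neq0. Qed.

Lemma syzygy_gen a b c : a * fx + b * fy + c * fz = 0 ->
  exists u v w, row3 a b c = v *: gen_v + u *: gen_u + w *: gen_w.
Proof.
move=> syz.
have A0 : a_ != 0 by exact: mpolyC_neq0.
have B0 : b_ != 0 by exact: mpolyC_neq0.
have C0 : c_ != 0 by exact: mpolyC_neq0.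
have D0 : d_ != 0 by exact: mpolyC_neq0.
have y0 := X_neq0 1.
have yl1 : y ^+ l.+1 = y ^+ l * y by exact: exprSr.
have yk0 j : y ^+ j != 0 by rewrite expf_neq0.
have xk0 j : x ^+ j != 0 by rewrite expf_neq0 ?X_neq0.
pose fy' := a_ * (x ^+ k * x ^+ l * x ^+ 3) + c_ * (y ^+ k * y ^+ l * y ^+ 2) * z.
(* [y ^ k] divides [b fy] and [c fz] but is prime to [fx]. *)
have [a1 aE] : exists a1, a = y ^+ k * a1.
  apply: (@dvd_mul_expX _ _ _ _ fx _ (- (b * fy' + c * (y ^+ k * y ^+ l * y ^+ 3)))).
    rewrite /fx subst0D !subst0M !subst0y_x !subst0C !subst0y_x1 !subst0y_y1 !mulr0 addr0.
    by rewrite !mulf_eq0 !negb_or D0 !xk0 !X_neq0.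
  by apply: (eq_of_sub0 _ syz); rewrite /fy /fz /fy'; ring.
have {}syz : a1 * fx + b * fy' + c * (y ^+ k * y ^+ l * y ^+ 3) = 0.
  apply: (mulfI (yk0 k)); rewrite mulr0 -[RHS]syz aE /fy /fz /fy'; ring.
(* Modulo y the relation reads x^(k+l+3) (d x^k a1 + (d1 - 1) b) = 0. *)
have [b1 b1E] : exists b1, d_ * x ^+ k * a1 + a_ * b = y ^+ 1 * b1.
  apply: (@dvd_mul_expX _ _ _ _ (x ^+ k * x ^+ l * x ^+ 3) _
    (- (a1 * b_ * (x ^+ k * x ^+ l * x ^+ 2 * y ^+ k) +
    b * c_ * (y ^+ k * y ^+ l * y) * z + c * (y ^+ k * y ^+ l * y ^+ 2)))).
    by rewrite !subst0M !subst0y_x !subst0y_x1 !mulf_eq0 !negb_or !xk0 !X_neq0.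
  by apply: (eq_of_sub0 _ syz); rewrite /fx /fy'; ring.
have {}syz : a_ * b_ * a1 * (x ^+ k * x ^+ l * x ^+ 2 * y ^+ k)
    - d_ * c_ * x ^+ k * (y ^+ k * y ^+ l * y) * z * a1
    + b1 * fy' + a_ * c * (y ^+ k * y ^+ l * y ^+ 2) = 0.
  apply: (mulfI y0); rewrite mulr0 -(mulr0 a_) -syz.
  by rewrite (_ : y * _ = y * (a_ * b_ * a1 * (x ^+ k * x ^+ l * x ^+ 2 * y ^+ k)
    - d_ * c_ * x ^+ k * (y ^+ k * y ^+ l * y) * z * a1
    + a_ * c * (y ^+ k * y ^+ l * y ^+ 2)) + (y ^+ 1 * b1) * fy');
    [rewrite -b1E /fx /fy' | ]; ring.
(* Every term except [b1 * fy'] is divisible by y^k, and [fy'] is prime to y. *)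
have [b2 b2E] : exists b2, b1 = y ^+ k * b2.
  apply: (@dvd_mul_expX _ _ _ _ fy' _ (- (a_ * b_ * a1 * (x ^+ k * x ^+ l * x ^+ 2)
    - d_ * c_ * x ^+ k * (y ^+ l * y) * z * a1 + a_ * c * (y ^+ l * y ^+ 2)))).
    rewrite /fy' subst0D !subst0M !subst0y_x !subst0C !subst0y_x1 !subst0y_y1.
    by rewrite !mulr0 mul0r addr0 !mulf_eq0 !negb_or A0 !xk0 !X_neq0.
  by apply: (eq_of_sub0 _ syz); ring.
have {}syz : a_ * b_ * a1 * (x ^+ k * x ^+ l * x ^+ 2)
    - d_ * c_ * x ^+ k * (y ^+ l * y) * z * a1
    + b2 * fy' + a_ * c * (y ^+ l * y ^+ 2) = 0.
  by apply: (mulfI (yk0 k)); rewrite mulr0 -[RHS]syz b2E; ring.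
(* Modulo y^(l+1) only the multiple [b_ * a1 + x * b2] of x^(k+l+2) survives, up to a nonzero
   constant. *)
have [e eE] : exists e, b_ * a1 + x * b2 = y ^+ l.+1 * e.
  apply: (@dvd_mul_expX _ _ _ _ (a_ * (x ^+ k * x ^+ l * x ^+ 2)) _
    (- (- (d_ * c_ * x ^+ k * z * a1) + b2 * c_ * (y ^+ k * y) * z + a_ * c * y))).
    by rewrite !subst0M !subst0y_x !subst0C !subst0y_x1 !mulf_eq0 !negb_or A0 !xk0 !X_neq0.
  by apply: (eq_of_sub0 _ syz); rewrite /fy' yl1; ring.
rewrite yl1 in eE.
have {}syz : a_ * (x ^+ k * x ^+ l * x ^+ 2) * e - d_ * c_ * x ^+ k * z * a1
    + c_ * (y ^+ k * y) * z * b2 + a_ * c * y = 0.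
  apply: (mulfI (yk0 l.+1)); rewrite mulr0 -[RHS]syz yl1.
  rewrite (_ : y ^+ l * y * _ = a_ * (x ^+ k * x ^+ l * x ^+ 2) * (y ^+ l * y * e) +
    y ^+ l * y * (- (d_ * c_ * x ^+ k * z * a1)
    + c_ * (y ^+ k * y) * z * b2 + a_ * c * y)); last by ring.
  by rewrite -eE /fy'; ring.
have a1E : b_ * a1 = y ^+ l * y * e - x * b2 by rewrite -eE addrK.
have {}syz' : a_ * b_ * (x ^+ k * x ^+ l * x ^+ 2) * e
    - d_ * c_ * x ^+ k * z * (y ^+ l * y * e - x * b2)
    + b_ * c_ * (y ^+ k * y) * z * b2 + a_ * b_ * c * y = 0.
  by rewrite -a1E -(mulr0 b_) -syz; ring.
(* With [a1] eliminated, cancelling x^(k+1) modulo y leaves the single congruence on the pair ([e],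
   [b2]). *)
have [t tE] : exists t, a_ * b_ * (x ^+ l * x) * e + d_ * c_ * z * b2 = y ^+ 1 * t.
  apply: (@dvd_mul_expX _ _ _ _ (x ^+ k * x) _ (d_ * c_ * x ^+ k * z * y ^+ l * e
    - b_ * (c_ * y ^+ k * z * b2 + a_ * c))).
    by rewrite -exprSr subst0y_x.
  by apply: (eq_of_sub0 _ syz'); ring.
(* The solutions of [al be x ^ l.+1 e + de ga z b2 = 0] modulo [y] are the
   multiples of [(de ga z, - al be x ^ l.+1)]. *)
have [e1 e1E] := subst0_decomp 1 e; have [b3 b3E] := subst0_decomp 1 b2.
have e0b0 : a_ * b_ * (x ^+ l * x) * subst0 1 e = - (d_ * c_ * z * subst0 1 b2).
  have := congr1 (subst0 1) tE; rewrite subst0D !subst0M !subst0C !subst0y_x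
    !subst0y_x1 expr1 !subst0y_y1 mul0r [subst0 1 z]subst0X => /eqP.
  by rewrite addr_eq0 => /eqP.
have [u1 u1E] : exists u1, subst0 1 e = z ^+ 1 * u1.
  apply: (@dvd_mul_expX _ _ _ _ (a_ * b_ * (x ^+ l * x)) _
    (- (d_ * c_ * subst0 1 b2))); last by rewrite e0b0; ring.
  rewrite -exprSr !subst0M subst0Xn !subst0C subst0X /=.
  by rewrite !mulf_eq0 !negb_or A0 B0 xk0.
have b0E : d_ * c_ * subst0 1 b2 = - (a_ * b_ * (x ^+ l * x) * u1).
  apply: (mulfI (X_neq0 2)); rewrite mulrN.
  apply/eqP; rewrite -eqr_oppLR; apply/eqP.
  rewrite (_ : - _ = - (d_ * c_ * z * subst0 1 b2)); last by ring.
  by rewrite -e0b0 u1E; ring.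
(* Inverting the constants rescales the solution so that the coefficients [u], [v], [w] match the
   generators exactly. *)
have inv (r : K) : r != 0 -> exists r', r%:MP * r' = 1 :> S.
  by move=> r0; exists (r^-1)%:MP; rewrite -mpolyCM divff.
have [a' aa'] := inv _ al0; have [b' bb'] := inv _ be0.
have [c' cc'] := inv _ ga0; have [d' dd'] := inv _ de0.
pose s := a' * b'.
pose u := s * (d' * c' * u1).
have uE : a_ * b_ * (d_ * c_ * u) = u1.
  rewrite (_ : _ * _ = (a_ * a') * (b_ * b') * (d_ * d') * (c_ * c') * u1).
    by rewrite aa' bb' cc' dd' !mul1r.
  by rewrite /u /s; ring.
have sE r : a_ * b_ * (s * r) = r.
  rewrite (_ : _ * _ = (a_ * a') * (b_ * b') * r); first by rewrite aa' bb' !mul1r.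
  by rewrite /s; ring.
pose w := s * e1; pose v := s * b3.
have eF : e = a_ * b_ * (d_ * c_ * z * u + y * w).
  by rewrite {1}e1E u1E -uE -(sE e1) /w; ring.
have bF : b2 = a_ * b_ * (- (a_ * b_ * (x ^+ l * x) * u) + y * v).
  have -> : b2 = - (a_ * b_ * (x ^+ l * x) * (a_ * b_ * u)) + y * b3.
    rewrite {1}b3E; congr (_ + _).
    apply: (mulfI (mulf_neq0 D0 C0)); rewrite b0E -uE; ring.
  by rewrite -(sE b3) /v; ring.
have aF : a1 = a_ * (y ^+ l * y * (d_ * c_ * z * u + y * w)
   + a_ * b_ * (x ^+ l * x ^+ 2) * u - x * y * v).
  by apply: (mulfI B0); rewrite a1E eF bF; ring.
have bG : b = - (d_ * x ^+ k * (y ^+ l * y * (d_ * c_ * z * u + y * w)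
   + a_ * b_ * (x ^+ l * x ^+ 2) * u - x * y * v))
   + b_ * (y ^+ k * y) * (- (a_ * b_ * (x ^+ l * x) * u) + y * v).
  apply: (mulfI A0); have -> : a_ * b = y ^+ 1 * b1 - d_ * x ^+ k * a1.
    by rewrite -b1E addrC addKr.
  by rewrite b2E bF aF; ring.
exists u, v, w.
apply/esym/row3_eq; rewrite comb3E !row3E.
- by rewrite aE aF /G; ring.
- by rewrite bG /G; ring.
(* The last coordinate is read off from the reduced relation, where it carries the factor
   [a_ * y]. *)
- apply: (mulfI (mulf_neq0 A0 y0)).
  have -> : a_ * y * c = - (a_ * (x ^+ k * x ^+ l * x ^+ 2) * e - d_ * c_ * x ^+ k * z * a1
    + c_ * (y ^+ k * y) * z * b2).
    by apply/eqP; rewrite -addr_eq0; apply/eqP; rewrite -[RHS]syz; ring.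
  by rewrite aF bF eF; ring.
Qed.
Lemma syzygy_v : gen_v 0 0 * fx + gen_v 0 1 * fy + gen_v 0 2 * fz = 0.
Proof. by rewrite /gen_v !row3E /fx /fy /fz; ring. Qed.

Lemma syzygy_u : gen_u 0 0 * fx + gen_u 0 1 * fy + gen_u 0 2 * fz = 0.
Proof. by rewrite /gen_u !row3E /fx /fy /fz /G; ring. Qed.

Lemma syzygy_w : gen_w 0 0 * fx + gen_w 0 1 * fy + gen_w 0 2 * fz = 0.
Proof. by rewrite /gen_w !row3E /fx /fy /fz; ring. Qed.

Definition gens (j : 'I_3) : 'rV[S]_3 := tnth [tuple gen_v; gen_u; gen_w] j.

Lemma gens_homog j :
  homog_triple (tnth [tuple k.+2; (k + l).+2; (k + l).+2] j) (gens j).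
Proof.
move: j; apply: forall_I3; rewrite /gens /homog_triple; apply: forall_I3;
  rewrite !tnth3E /gen_v /gen_u /gen_w row3E /G /a_ /b_ /c_ /d_; homog_auto.
Qed.

Lemma gens_minimal (f : S) :
  f^`M(0) = fx -> f^`M(1) = fy -> f^`M(2) = fz -> minimally_generates (AR f) gens.
Proof.
move=> f0 f1 f2.
have AR_gens j : AR f (gens j).
  rewrite /AR /mkset /= sum_I3 f0 f1 f2; move: j.
  by apply: forall_I3; [exact: syzygy_v | exact: syzygy_u | exact: syzygy_w].
pose P (i : 'I_3) : K := (i == 1)%:R; pose Q (i : 'I_3) : K := (i == 0)%:R.
apply: (@minimally_generates_row3 _ _ P Q AR_gens).
- move=> s; rewrite {1}(row3_eq (erefl (s 0 0)) (erefl _) (erefl _)).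
  move=> /AR_row3; rewrite f0 f1 f2 => /syzygy_gen [u [v [w e]]].
  exists (fun j => tnth [tuple v; u; w] j); rewrite sum_I3 !tnth3E -e.
  exact: row3_eq.
all: rewrite /gens tnth3E /gen_v /gen_u /gen_w row3E /G /a_ /b_ /c_ /d_
   !mevalRE /P /Q /=.
all: rewrite ?(mulr0, mul0r, addr0, add0r, oppr0, mulr1, mul1r, expr1n, expr0n) //.
by rewrite oppr_eq0 !mulf_eq0 !negb_or de0 al0.
Qed.

End GeneralCase.

(** * Syzygies in the case d1 = 1, where f = 2 x^d + y^(d-1) z *)

Section MonomialCase.
Variables (n : nat) (al ga : K).
Hypotheses (al0 : al != 0) (ga0 : ga != 0).
Let a_ : S := al%:MP.
Let c_ : S := ga%:MP.
Let fx : S := a_ * (x ^+ n * x).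
Let fy : S := c_ * y ^+ n * z.
Let fz : S := y ^+ n * y.

(** The first is the Koszul syzygy of [fy] and [fz] divided by their common factor y^n; the others
    are the Koszul syzygies of [fx] with [fy] and with [fz]. *)
Definition gens1 (j : 'I_3) : 'rV[S]_3 :=
  tnth [tuple row3 0 y (- (c_ * z));
              row3 (c_ * y ^+ n * z) (- (a_ * (x ^+ n * x))) 0;
              row3 (y ^+ n * y) 0 (- (a_ * (x ^+ n * x)))] j.

Lemma gens1_homog j : homog_triple (tnth [tuple 1%N; n.+1; n.+1] j) (gens1 j).
Proof.
move: j; apply: forall_I3; rewrite /gens1 /homog_triple; apply: forall_I3;
  rewrite !tnth3E row3E /a_ /c_; (exact: rpred0 || homog_auto).
Qed.

(** One division by y^n already leads to the final congruence modulo y, between [a1] and [b]. *)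
Lemma syzygy_gen1 a b c : a * fx + b * fy + c * fz = 0 ->
  exists u v w, row3 a b c = v *: gens1 0 + u *: gens1 1 + w *: gens1 2.
Proof.
move=> syz.
have A0 : a_ != 0 by exact: mpolyC_neq0.
have C0 : c_ != 0 by exact: mpolyC_neq0.
have y0 := X_neq0 1.
have xk0 j : x ^+ j != 0 by rewrite expf_neq0 ?X_neq0.
have [a1 aE] : exists a1, a = y ^+ n * a1.
  apply: (@dvd_mul_expX _ _ _ _ fx _ (- (b * c_ * z + c * y))).
    rewrite /fx !subst0M !subst0y_x !subst0C !subst0y_x1.
    by rewrite !mulf_eq0 !negb_or A0 !xk0 X_neq0.
  by apply: (eq_of_sub0 _ syz); rewrite /fy /fz; ring.
have {}syz : a_ * (x ^+ n * x) * a1 + c_ * z * b + y * c = 0.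
  apply: (mulfI (expf_neq0 n y0)); rewrite mulr0 -[RHS]syz aE /fx /fy /fz; ring.
have [w a1E] := subst0_decomp 1 a1; have [v bE] := subst0_decomp 1 b.
have e0b0 : a_ * (x ^+ n * x) * subst0 1 a1 = - (c_ * z * subst0 1 b).
  have := congr1 (subst0 1) syz; rewrite subst00 !subst0D !subst0M !subst0C subst0y_x
    !subst0y_x1 !subst0y_y1 mul0r addr0 [subst0 1 z]subst0X.
  by move/eqP; rewrite addr_eq0 => /eqP.
have [u1 u1E] : exists u1, subst0 1 a1 = z ^+ 1 * u1.
  apply: (@dvd_mul_expX _ _ _ _ (a_ * (x ^+ n * x)) _ (- (c_ * subst0 1 b)));
    last by rewrite e0b0; ring.
  rewrite -exprSr !subst0M subst0Xn !subst0C subst0X /=.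
  by rewrite !mulf_eq0 !negb_or A0 xk0.
have b0E : c_ * subst0 1 b = - (a_ * (x ^+ n * x) * u1).
  apply: (mulfI (X_neq0 2)); rewrite mulrN.
  apply/eqP; rewrite -eqr_oppLR; apply/eqP.
  rewrite (_ : - _ = - (c_ * z * subst0 1 b)); last by ring.
  by rewrite -e0b0 u1E; ring.
pose u := (ga^-1)%:MP * u1.
have uE : u1 = c_ * u by rewrite /u mulrA -mpolyCM divff // mul1r.
have aF : a1 = c_ * z * u + y * w by rewrite {1}a1E u1E uE; ring.
have bF : b = - (a_ * (x ^+ n * x) * u) + y * v.
  by rewrite {1}bE; congr (_ + _); apply: (mulfI C0); rewrite b0E uE; ring.
exists u, v, w.
apply/esym/row3_eq; rewrite comb3E /gens1 !tnth3E !row3E.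
- by rewrite aE aF; ring.
- by rewrite bF; ring.
- apply: (mulfI y0).
  have -> : y * c = - (a_ * (x ^+ n * x) * a1 + c_ * z * b).
    by apply/eqP; rewrite -addr_eq0 addrC; apply/eqP.
  by rewrite aF bF; ring.
Qed.

Lemma gens1_minimal (f : S) :
  f^`M(0) = fx -> f^`M(1) = fy -> f^`M(2) = fz -> minimally_generates (AR f) gens1.
Proof.
move=> f0 f1 f2.
have AR_gens j : AR f (gens1 j).
  rewrite /AR /mkset /= sum_I3 f0 f1 f2 /fx /fy /fz; move: j.
  by apply: forall_I3; rewrite /gens1 tnth3E !row3E; ring.
pose P (i : 'I_3) : K := (i == 1)%:R; pose Q (i : 'I_3) : K := (i == 0)%:R.
apply: (@minimally_generates_row3 _ _ P Q AR_gens).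
- move=> s; rewrite {1}(row3_eq (erefl (s 0 0)) (erefl _) (erefl _)).
  move=> /AR_row3; rewrite f0 f1 f2 => /syzygy_gen1 [u [v [w e]]].
  exists (fun j => tnth [tuple v; u; w] j); rewrite sum_I3 !tnth3E -e.
  exact: row3_eq.
all: rewrite /gens1 tnth3E row3E /a_ /c_ ?meval0 ?mevalRE /P /Q /=.
all: rewrite ?(mulr0, mul0r, oppr0, mulr1, expr1n) ?oner_neq0 //.
by rewrite oppr_eq0.
Qed.
End MonomialCase.

(** * Partial derivatives of the curve and choice of generators *)

Lemma mderivXU (i j : 'I_3) : ('X_j : S)^`M(i) = (i == j)%:R.
Proof.
rewrite mderivX mnm1E eq_sym; case: eqVneq => [->|_]; last by rewrite scale0r.
by rewrite scale1r -mpolyX0; congr 'X_[_]; apply/mnmP => k; rewrite mnmBE mnm0E subnn.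
Qed.

Lemma mderivXn (i : 'I_3) (p : S) n : (p ^+ n)^`M(i) = p ^+ n.-1 * p^`M(i) *+ n.
Proof.
elim: n => [|n IHn]; first by rewrite mulr0n expr0 -mpolyC1 mderivC.
rewrite exprS mderivM IHn /=; case: n {IHn} => [|n].
  by rewrite mulr0n mulr0 addr0 mulr1n mulrC.
by rewrite /= -mulrnAr mulrA -exprS [in RHS]mulrSr mulrnAr [_^`M(i) * _]mulrC addrC.
Qed.

(** For d1 = 1 the truncated exponent [d1 - 2] does no harm: its term carries the factor [d1 - 1],
    which is zero. *)
Lemma curve_deriv d d1 d2 :
  [/\ (curve_eq K d d1 d2)^`M(0) =
        x ^+ d.-1 *+ d + x ^+ d2 *+ d2.+1 * y ^+ (d1 - 1),
      (curve_eq K d d1 d2)^`M(1) =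
        x ^+ d2.+1 * (y ^+ (d1 - 2) *+ (d1 - 1)) + y ^+ (d - 2) *+ (d - 1) * z &
      (curve_eq K d d1 d2)^`M(2) = y ^+ (d - 1)].
Proof.
have e1 : ((1 : 'I_3) == 0) = false by [].
have e2 : ((0 : 'I_3) == 1) = false by [].
have e3 : ((0 : 'I_3) == 2) = false by [].
have e4 : ((1 : 'I_3) == 2) = false by [].
have e5 : ((2 : 'I_3) == 0) = false by [].
have e6 : ((2 : 'I_3) == 1) = false by [].
rewrite /curve_eq addn1 !mderivD !mderivM !mderivXn !mderivXU.
rewrite !eqxx !e1 !e2 !e3 !e4 !e5 !e6 !(mulr0, mul0r, mul0rn, mulr1, addr0, add0r).
by rewrite /= !subnS.
Qed.

Lemma curve_minimally_generated d d1 d2 :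
  (1 <= d1)%N -> (2 * d1 <= d)%N -> d2 = (d - d1)%N ->
  exists g : 'I_3 -> 'rV[S]_3,
    (forall j, homog_triple (tnth [tuple d1; d2; d2] j) (g j)) /\
    minimally_generates (AR (curve_eq K d d1 d2)) g.
Proof.
move=> hd1 hd hd2.
have nat0 k : (0 < k)%N -> k%:R != 0 :> K by rewrite pnatr_eq0 -lt0n.
have [f0 f1 f2] := curve_deriv d d1 d2.
have [d1E|d1_gt1] := eqVneq d1 1%N.
  (* The two powers of x merge, so [fx] has the coefficient 2d, here [n.+2 + n.+2]. *)
  subst d1; have [n dE] : exists n, d = n.+2 by exists d.-2; lia.
  have {hd2} d2E : d2 = n.+1 by lia.
  subst d d2; exists (gens1 n (n.+2 + n.+2)%:R n.+1%:R); split=> [j|].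
    by apply: gens1_homog; rewrite nat0.
  refine (gens1_minimal (nat0 _ _) (nat0 _ _) _ _ _) => //; rewrite ?f0 ?f1 ?f2 ?mpolyC_nat.
  - by rewrite /= subnn mulr1 natrD mulrDl !mulr_natl -exprSr.
  - by rewrite !subSS !subn0 mulr0n mulr0 add0r mulr_natl.
  - by rewrite subSS subn0 exprSr.
have [k d1E] : exists k, d1 = k.+2 by exists d1.-2; lia.
have [l d2E] : exists l, d2 = (k + l).+2 by exists (d2 - d1)%N; lia.
have dE : d = (k + k + l).+4 by lia.
subst d1; rewrite d2E dE in f0 f1 f2 *.
exists (gens k l k.+1%:R (k + l).+3%:R (k + k + l).+3%:R (k + k + l).+4%:R).
split=> [j|]; first by apply: gens_homog; rewrite nat0.
refine (gens_minimal (nat0 _ _) (nat0 _ _) (nat0 _ _) (nat0 _ _) _ _ _) => //;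
  rewrite ?f0 ?f1 ?f2 ?mpolyC_nat.
- rewrite /= !subSS subn0 !mulr_natl -!exprD -!exprSr -mulrnAl.
  by congr (_ ^+ _ *+ _ + _ ^+ _ *+ _ * _ ^+ _); lia.
- have -> : x ^+ (k + l).+3 = x ^+ k * x ^+ l * x ^+ 3.
    by rewrite -!exprD; congr (_ ^+ _); lia.
  have -> : y ^+ ((k + k + l).+4 - 2) = y ^+ k * (y ^+ k * y ^+ l * y ^+ 2).
    by rewrite -!exprD; congr (_ ^+ _); lia.
  have -> : (k.+2 - 2)%N = k by lia.
  have -> : (k.+2 - 1)%N = k.+1 by lia.
  have -> : ((k + k + l).+4 - 1)%N = (k + k + l).+3 by lia.
  rewrite -(mulr_natl (y ^+ k) k.+1).
  rewrite -(mulr_natl (y ^+ k * (y ^+ k * y ^+ l * y ^+ 2)) (k + k + l).+3).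
  move: (k.+1%:R : S) ((k + k + l).+3%:R : S) => r1 r2.
  ring.
- by rewrite -!exprD; congr (_ ^+ _); lia.
Qed.

End Syzygies.

(** * Factorization of convergent power series *)

Section Series.
Variable K : numFieldType.
Implicit Types a b c : series2 K.

Lemma mul_series00 a b : mul_series a b 0%N 0%N = a 0%N 0%N * b 0%N 0%N.
Proof. by rewrite /mul_series !big_ord1. Qed.

Lemma unit_series_neq0 a : unit_series a -> a 0%N 0%N != 0.
Proof.
case=> b [_ ab]; have := ab 0%N 0%N; rewrite mul_series00 /one_series eqxx /=.
by move=> h; apply/eqP => a0; move/eqP: h; rewrite a0 mul0r eq_sym oner_eq0.
Qed.

(** The Cauchy product without the term of [a 0 0]; it sees only coefficients of [b] of total degree
    below i + j, which permits recursion. *)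
Definition tail_mul a b i j : K :=
  \sum_(k < i.+1) \sum_(l < j.+1)
    if (k + l == 0)%N then 0 else a k l * b (i - k)%N (j - l)%N.

Lemma mul_seriesE a b i j :
  mul_series a b i j = a 0%N 0%N * b i j + tail_mul a b i j.
Proof.
rewrite /mul_series /tail_mul [LHS]big_ord_recl [in RHS]big_ord_recl.
rewrite [X in X + _ = _]big_ord_recl [X in _ = _ + (X + _)]big_ord_recl /= !subn0.
by rewrite add0r -addrA.
Qed.

Lemma eq_tail_mul a b c i j :
  (forall k l, (k <= i)%N -> (l <= j)%N -> (k + l < i + j)%N -> b k l = c k l) ->
  tail_mul a b i j = tail_mul a c i j.
Proof.
move=> bc; apply: eq_bigr => k _; apply: eq_bigr => l _.
case: eqP => // kl; congr (_ * _); apply: bc; rewrite ?leq_subr //.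
by have := ltn_ord k; have := ltn_ord l; move: kl; lia.
Qed.

(** * Inverse of a series with nonzero constant term *)

Section Inverse.
Variable a : series2 K.
Hypothesis a0 : a 0%N 0%N != 0.

(** Iterates the fixed-point equation of the inverse from zero; the n-th iterate is already final in
    total degree below n, and [inv_series] reads each coefficient at that stage. *)
Fixpoint approx_inv (n : nat) : series2 K :=
  if n is n'.+1 then
    fun i j => (a 0%N 0%N)^-1 * (one_series K i j - tail_mul a (approx_inv n') i j)
  else fun _ _ => 0.

Definition inv_series : series2 K := fun i j => approx_inv (i + j).+1 i j.

Lemma approx_inv_stable n i j : (i + j < n)%N -> approx_inv n i j = inv_series i j.
Proof.
move: {2}(i + j)%N (leqnn (i + j)) => N.
elim: N n i j => [|N IHN] [|n] i j ijN //= ijn; rewrite /inv_series /=;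
  congr (_ * (_ - _)); apply: eq_tail_mul => k l ki lj kl.
  by move: kl; rewrite ltnNge (leq_trans ijN).
rewrite [LHS]IHN ?[RHS]IHN //; by move: kl ijN ijn; lia.
Qed.

Lemma mul_inv_series : mul_series a inv_series =2 one_series K.
Proof.
move=> i j; rewrite mul_seriesE {1}/inv_series /= mulrA divff // mul1r.
rewrite [X in _ - X](_ : _ = tail_mul a inv_series i j) ?subrK //.
by apply: eq_tail_mul => k l _ _ kl; exact: approx_inv_stable.
Qed.

Lemma inv_seriesE i j :
  inv_series i j = (a 0%N 0%N)^-1 * (one_series K i j - tail_mul a inv_series i j).
Proof.
rewrite {1}/inv_series /=; congr (_ * (_ - _)).
by apply: eq_tail_mul => k l _ _ kl; exact: approx_inv_stable.
Qed.

(* [r] is so small that the nonconstant terms of [a] sum up to at most half of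
   the constant term; then [r ^ (i + j)] times the coefficients of the inverse
   stays bounded, by induction on [i + j]. *)
Lemma inv_series_bound r : 0 < r ->
  (forall i j, \sum_(k < i.+1) \sum_(l < j.+1)
     (if (k + l == 0)%N then 0 else `|a k l| * r ^+ (k + l)) <=
     `|a 0%N 0%N| / 2%:R) ->
  forall i j, `|inv_series i j| * r ^+ (i + j) <= `|a 0%N 0%N|^-1.
Proof.
move=> r0 ar i j; move: {2}(i + j)%N (leqnn (i + j)) => N.
have A0 : 0 < `|a 0%N 0%N| by rewrite normr_gt0.
elim: N i j => [|N IHN] i j.
  rewrite leqn0 addn_eq0 => /andP[/eqP -> /eqP ->].
  rewrite mulr1 inv_seriesE /tail_mul !big_ord1 /= subr0 /one_series /= mulr1.
  by rewrite normfV.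
move=> ijN; have [/eqP|ij0] := eqVneq (i + j)%N 0%N.
  move=> ij; apply: (IHN i j); by rewrite (eqP ij).
rewrite inv_seriesE /one_series.
have -> : (i == 0%N) && (j == 0%N) = false by move: ij0; case: (i) (j) => [|?] [|?].
rewrite sub0r mulrN normrN normrM normfV -mulrA -[leRHS]mulr1.
rewrite ler_wpM2l ?invr_ge0 //.
have le1 : `|tail_mul a inv_series i j| * r ^+ (i + j) <=
    (`|a 0%N 0%N| / 2%:R) * `|a 0%N 0%N|^-1.
  apply: le_trans (ler_wpM2r _ (ar i j)); last by rewrite invr_ge0.
  rewrite /tail_mul; apply: le_trans (ler_wpM2r _ (ler_norm_sum _ _ _)) _.
    by rewrite exprn_ge0 // ltW.
  rewrite !mulr_suml; apply: ler_sum => k _.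
  apply: le_trans (ler_wpM2r _ (ler_norm_sum _ _ _)) _.
    by rewrite exprn_ge0 // ltW.
  rewrite !mulr_suml; apply: ler_sum => l _.
  case: eqP => [|kl]; first by rewrite normr0 !mul0r.
  have -> : r ^+ (i + j) = r ^+ (k + l) * r ^+ ((i - k) + (j - l)).
    by rewrite -exprD; congr (_ ^+ _); have := ltn_ord k; have := ltn_ord l; lia.
  rewrite normrM mulrACA ler_wpM2l ?mulr_ge0 ?exprn_ge0 ?(ltW r0) //.
  by apply: IHN; have := ltn_ord k; have := ltn_ord l; lia.
apply: le_trans le1 _.
by rewrite mulrAC divff ?gt_eqF // mul1r invf_le1 ?ltr0n // ler1n.
Qed.

End Inverse.

Lemma geometric_sum_le N : \sum_(i < N) (2%:R^-1 : K) ^+ i <= 2%:R.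
Proof.
suff -> : \sum_(i < N) (2%:R^-1 : K) ^+ i = 2%:R - 2%:R * 2%:R^-1 ^+ N.
  by rewrite lerBlDr lerDl mulr_ge0 ?exprn_ge0 ?invr_ge0 ?ler0n.
elim: N => [|N IHN]; first by rewrite big_ord0 mulr1 subrr.
by rewrite big_ord_recr /= IHN exprS; field.
Qed.

(** At half the radius the series is dominated by M times a product of two geometric series of ratio
    1/2, each summing to at most 2. *)
Lemma bounded_convergent b (r M : K) : 0 < r ->
  (forall i j, `|b i j| * r ^+ (i + j) <= M) -> convergent b.
Proof.
move=> r0 bM; exists (r / 2%:R), (M * (2%:R * 2%:R)); split=> [|N].
  by rewrite divr_gt0 ?ltr0n.
have M0 : 0 <= M.
  by apply: le_trans (bM 0%N 0%N); rewrite mulr_ge0 ?exprn_ge0 // ltW.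
have -> : M * (2%:R * 2%:R) = M * 2%:R * 2%:R by rewrite mulrA.
apply: (@le_trans _ _ (\sum_(i < N) M * 2%:R * 2%:R^-1 ^+ i)); last first.
  by rewrite -mulr_sumr ler_wpM2l ?geometric_sum_le // mulr_ge0 ?ler0n.
apply: ler_sum => i _.
apply: (@le_trans _ _ (\sum_(j < N) M * 2%:R^-1 ^+ i * 2%:R^-1 ^+ j)).
  apply: ler_sum => j _; rewrite exprMn mulrA -[leRHS]mulrA -exprD.
  by rewrite ler_wpM2r // exprn_ge0 // invr_ge0 ler0n.
rewrite -mulr_sumr [leRHS]mulrAC ler_wpM2l ?geometric_sum_le //.
by rewrite mulr_ge0 ?exprn_ge0 ?invr_ge0 ?ler0n.
Qed.

Lemma unit_series_of_neq0 a : convergent a -> a 0%N 0%N != 0 -> unit_series a.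
Proof.
move=> [r [M [r0 aM]]] a0; exists (inv_series a); split; last exact: mul_inv_series.
have A0 : 0 < `|a 0%N 0%N| by rewrite normr_gt0.
have M0 : 0 <= M by have := aM 0%N; rewrite big_ord0.
(* Shrinking the radius by [th <= 1] multiplies each nonconstant term by at most [th], and [th * M]
   is at most half the constant term. *)
pose th := `|a 0%N 0%N| / (2%:R * (M + `|a 0%N 0%N|)).
have MA : 0 < M + `|a 0%N 0%N| by rewrite ltr_wpDl.
have th0 : 0 < th by rewrite divr_gt0 // mulr_gt0 ?ltr0n.
have th1 : th <= 1.
  rewrite ler_pdivrMr ?mulr_gt0 ?ltr0n // mul1r mulr_natl mulr2n.
  by rewrite -[leLHS]add0r lerD ?lerDr // ltW.
have thM : th * M <= `|a 0%N 0%N| / 2%:R.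
  rewrite /th invfM mulrA -mulrA ler_piMr ?divr_ge0 ?ler0n // mulrC.
  by rewrite ler_pdivrMr // mul1r lerDl ltW.
apply: (@bounded_convergent _ (r * th) `|a 0%N 0%N|^-1); first exact: mulr_gt0.
apply: inv_series_bound => // [|i j]; first exact: mulr_gt0.
apply: le_trans thM.
(* A square of side [N] contains the rectangle of indices, so the bound on square sums applies. *)
pose N := (i + j).+1.
apply: le_trans (ler_wpM2l (ltW th0) (aM N)).
rewrite mulr_sumr.
have pos k l : 0 <= th * (`|a k l| * r ^+ (k + l)).
  exact: mulr_ge0 (ltW th0) (mulr_ge0 (normr_ge0 _) (exprn_ge0 _ (ltW r0))).
rewrite (big_ord_widen N (fun k => \sum_(l < j.+1) (if (k + l == 0)%N then 0
  else `|a k l| * (r * th) ^+ (k + l)))) ?ltnS ?leq_addr //.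
rewrite big_mkcond; apply: ler_sum => k _; rewrite mulr_sumr; case: ifP => _; last first.
  by apply: sumr_ge0 => l _.
rewrite (big_ord_widen N (fun l => if (k + l == 0)%N then 0
  else `|a k l| * (r * th) ^+ (k + l))) ?ltnS ?leq_addl //.
rewrite big_mkcond; apply: ler_sum => l _; case: ifP => _ //; case: eqP => // /eqP.
rewrite -lt0n; case: (k + l)%N (pos k l) => // n pn _.
rewrite exprMn [leRHS]mulrCA ler_wpM2l // [leLHS]mulrC ler_wpM2r ?exprn_ge0 ?(ltW r0) //.
by rewrite exprS ler_piMr ?(ltW th0) // exprn_ile1 // ltW.
Qed.

Lemma finite_support_convergent a N :
  (forall i j, (N <= i + j)%N -> a i j = 0) -> convergent a.
Proof.
move=> aN.
apply: (@bounded_convergent _ 1 (\sum_(i < N) \sum_(j < N) `|a i j|)) => // i j.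
rewrite expr1n mulr1.
have [/aN ->|ij] := leqP N (i + j).
  by rewrite normr0; apply: sumr_ge0 => k _; apply: sumr_ge0.
have iN : (i < N)%N by lia.
have jN : (j < N)%N by lia.
rewrite (bigD1 (Ordinal iN)) //= (bigD1 (Ordinal jN)) //= -addrA lerDl.
by apply: addr_ge0; apply: sumr_ge0 => // k _; apply: sumr_ge0.
Qed.

(** * Supports, weights and irreducibility *)

Lemma sum_neq0_ex (I : finType) (F : I -> K) :
  \sum_i F i != 0 -> exists i, F i != 0.
Proof.
move=> h; apply/existsP; apply: contraNT h => /existsPn h.
by rewrite big1 // => i _; apply/eqP; move: (h i); rewrite negbK.
Qed.

Lemma mul_series_neq0 b c i j : mul_series b c i j != 0 ->
  exists k l, [/\ (k <= i)%N, (l <= j)%N, b k l != 0 & c (i - k)%N (j - l)%N != 0].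
Proof.
case/sum_neq0_ex => k /sum_neq0_ex [l]; rewrite mulf_eq0 => /norP[bkl ckl].
by exists k, l; split=> //; rewrite -ltnS ltn_ord.
Qed.

(** Selects an initial monomial for the weight q i + p j, ties broken by the smaller i. The product
    of two initial monomials cannot be cancelled by other terms. *)
Lemma lex_min_support (p q : nat) b i0 j0 : b i0 j0 != 0 ->
  exists i j, b i j != 0 /\ forall k l, b k l != 0 ->
    (q * i + p * j <= q * k + p * l)%N /\
    ((q * i + p * j)%N = (q * k + p * l)%N -> (i <= k)%N).
Proof.
move=> b0.
pose P n := `[< exists i j, b i j != 0 /\ n = (q * i + p * j)%N >].
have exP : exists n, P n by exists (q * i0 + p * j0)%N; apply/asboolP; exists i0, j0.
case: (ex_minnP exP) => W /asboolP [i1 [j1 [b1 W1]]] minW.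
pose Q i := `[< exists j, b i j != 0 /\ W = (q * i + p * j)%N >].
have exQ : exists n, Q n by exists i1; apply/asboolP; exists j1.
case: (ex_minnP exQ) => i /asboolP [j [bij Wij]] mini.
exists i, j; split=> // k l bkl; rewrite -Wij; split.
  by apply: minW; apply/asboolP; exists k, l.
by move=> Wkl; apply: mini; apply/asboolP; exists l.
Qed.

(* The support of [a] lies on or above the segment from [(p, 0)] to [(0, q)],
   which carries no further lattice point.  In a factorization into nonunits both
   endpoints force the minimal weights of the factors to be [q k] and [p l] with
   [0 < k < p], whereas these weights must coincide. *)
Lemma irreducible_series_segment (p q : nat) a :
  (0 < p)%N -> (0 < q)%N -> coprime p q -> convergent a ->
  (forall i j, a i j != 0 -> (p * q <= q * i + p * j)%N) ->
  a p 0%N != 0 -> a 0%N q != 0 -> irreducible_series a.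
Proof.
move=> p0 q0 pq ca supp ap aq; split=> //; first by exists p, 0%N.
  by move=> /unit_series_neq0 /supp; rewrite !muln0 leqn0 muln_eq0; lia.
move=> b c cb cc abc.
have [b00|b00] := eqVneq (b 0%N 0%N) 0; last by left; exact: unit_series_of_neq0.
have [c00|c00] := eqVneq (c 0%N 0%N) 0; last by right; exact: unit_series_of_neq0.
exfalso.
rewrite abc in ap; rewrite abc in aq.
have [k [l [kp]]] := mul_series_neq0 ap; rewrite leqn0 => /eqP -> {l} bk; rewrite subn0 => ck.
have [m [l []]] := mul_series_neq0 aq; rewrite leqn0 => /eqP -> {m} lq bl; rewrite subn0 => cl.
have [i1 [j1 [b1 min1]]] := lex_min_support p q bk.
have [i2 [j2 [c2 min2]]] := lex_min_support p q ck.
(* The product of the two initial monomials survives in [a]: any other contributing pair would need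
   equal weights, hence equal first indices by minimality, hence equal second ones. *)
have : (p * q <= q * (i1 + i2) + p * (j1 + j2))%N.
  apply: supp; rewrite abc /mul_series.
  have i1P : (i1 < (i1 + i2).+1)%N by rewrite ltnS leq_addr.
  have j1P : (j1 < (j1 + j2).+1)%N by rewrite ltnS leq_addr.
  rewrite (bigD1 (Ordinal i1P)) //= (bigD1 (Ordinal j1P)) //= !addKn.
  have eq0 x y : (x <= i1 + i2)%N -> (y <= j1 + j2)%N -> (x != i1) || (y != j1) ->
      b x y * c (i1 + i2 - x)%N (j1 + j2 - y)%N = 0.
    move=> xi yj xy; apply/eqP; rewrite mulf_eq0; apply/norP => -[bxy cxy].
    have [le1 eq1] := min1 _ _ bxy; have [le2 eq2] := min2 _ _ cxy.
    have ex : (q * i1 + q * i2 = q * x + q * (i1 + i2 - x))%N.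
      by rewrite -!mulnDr subnKC.
    have ey : (p * j1 + p * j2 = p * y + p * (j1 + j2 - y))%N.
      by rewrite -!mulnDr subnKC.
    have e1 : (q * i1 + p * j1)%N = (q * x + p * y)%N.
      by move: le1 le2 ex ey; clear; lia.
    have e2 : (q * i2 + p * j2)%N = (q * (i1 + i2 - x) + p * (j1 + j2 - y))%N.
      by move: le1 le2 ex ey; clear; lia.
    have xi1 : x = i1 by have := eq1 e1; have := eq2 e2; move: xi; clear; lia.
    move: xy e1; rewrite xi1 eqxx /= => yj1 /addnI /eqP.
    by rewrite eqn_pmul2l // eq_sym (negPf yj1).
  rewrite [X in _ + X + _]big1 ?[X in _ + X]big1.
  - by rewrite !addr0 mulf_neq0.
  - move=> x xi1; rewrite big1 // => y _; apply: (eq0 _ _ (ltn_ord x) (ltn_ord y)).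
    by rewrite -val_eqE /= in xi1; rewrite xi1.
  - move=> y yj1; rewrite -(eq0 i1 y) ?addKn ?leq_addr //; first exact: (ltn_ord y).
    by rewrite -val_eqE /= in yj1; rewrite yj1 orbT.
have [w1 _] := min1 _ _ bk; have [w2 _] := min2 _ _ ck.
have [w3 _] := min1 _ _ bl; have [w4 _] := min2 _ _ cl.
move=> W.
have ek : (q * k + q * (p - k) = p * q)%N by rewrite -mulnDr subnKC // mulnC.
have el : (p * l + p * (q - l) = p * q)%N by rewrite -mulnDr subnKC.
(* The minimal weights add up to at least pq, so each upper bound from the endpoints is attained,
   and the minimal weight of [b] is both qk and pl. *)
have e : (q * k = p * l)%N.
  by move: w1 w2 w3 w4 W ek el; rewrite !mulnDr !muln0; clear; lia.
have : (p %| k)%N by rewrite -(Gauss_dvdr _ pq) e dvdn_mulr.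
(* So [k] is 0 or p, which contradicts the vanishing constant term of [b] or of [c]. *)
case/dvdnP => [[|[|x]] kx].
- by move: bk; rewrite kx mul0n b00 eqxx.
- by move: ck; rewrite kx mul1n subnn c00 eqxx.
- by move: kp; rewrite kx -[leqRHS]mul1n leq_pmul2r.
Qed.

End Series.

(** * The conical twist *)

Section ConicalTwist.
Variable K : numClosedFieldType.
Implicit Types (s t c : K) (w : K * K) (m : nat).

(* Instance resolution does not see through the topology that [K] inherits from
   its [numClosedFieldType] structure. *)
#[local] Instance nbhs_filter1 (x : K) : Filter (nbhs x) := nbhs_filter x.
#[local] Instance nbhs_filter2 (w : K * K) : Filter (nbhs w) := nbhs_filter w.

(** This is 2 max(|s|^2, 4 |t|^2), with the maximum expressed through an absolute value. *)
Definition cone_den s t : K :=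
  `|s| ^+ 2 + 4%:R * `|t| ^+ 2 + `| `|s| ^+ 2 - 4%:R * `|t| ^+ 2 |.

(** Extends t / s from the cone 2 |t| <= |s| continuously to the complement of the origin, keeping
    it constant on complex lines and of modulus at most 1/2. *)
Definition cone_ratio s t : K := 2%:R * s^* * t / cone_den s t.

Definition twist m s t : K := - (1 + cone_ratio s t ^+ m).

Lemma cone_den_ge s t : 4%:R * (`|s| * `|t|) <= cone_den s t.
Proof.
have h : 0 <= (`|s| - 2%:R * `|t|) ^+ 2.
  by rewrite real_exprn_even_ge0 // realB ?realM ?normr_real ?realn.
rewrite -subr_ge0 [X in 0 <= X](_ : _ = (`|s| - 2%:R * `|t|) ^+ 2 +
  `| `|s| ^+ 2 - 4%:R * `|t| ^+ 2 |); first by rewrite addr_ge0.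
by rewrite /cone_den; ring.
Qed.

Lemma cone_den_gt0 s t : (s != 0) || (t != 0) -> 0 < cone_den s t.
Proof.
move=> h; rewrite /cone_den ltr_wpDr //.
have [s0|s0] := boolP (s == 0).
  rewrite s0 /= in h; rewrite ltr_wpDl ?exprn_ge0 //.
  by rewrite mulr_gt0 ?ltr0n // exprn_gt0 // normr_gt0.
by rewrite ltr_pwDl ?exprn_gt0 ?normr_gt0 // mulr_ge0 ?ler0n // exprn_ge0.
Qed.

Lemma cone_den_scale c s t : cone_den (c * s) (c * t) = `|c| ^+ 2 * cone_den s t.
Proof.
rewrite /cone_den !normrM !exprMn.
have -> : `|c| ^+ 2 * `|s| ^+ 2 - 4%:R * (`|c| ^+ 2 * `|t| ^+ 2) =
  `|c| ^+ 2 * (`|s| ^+ 2 - 4%:R * `|t| ^+ 2) by ring.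
rewrite normrM [`| `|c| ^+ 2 |]ger0_norm ?exprn_ge0 //; ring.
Qed.

Lemma cone_ratio_scale c s t :
  c != 0 -> cone_ratio (c * s) (c * t) = cone_ratio s t.
Proof.
move=> c0; rewrite /cone_ratio cone_den_scale rmorphM /=.
have -> : 2%:R * (c^* * s^*) * (c * t) = `|c| ^+ 2 * (2%:R * s^* * t).
  by rewrite normCK; ring.
by rewrite -mulf_div divff ?mul1r // expf_eq0 normr_eq0 (negPf c0) andbF.
Qed.

Lemma norm_cone_ratio s t : `|cone_ratio s t| <= 2%:R^-1.
Proof.
have [|/norP[/negPn/eqP -> /negPn/eqP ->]] := boolP ((s != 0) || (t != 0)); last first.
  by rewrite /cone_ratio mulr0 mul0r normr0 invr_ge0 ler0n.
move=> /cone_den_gt0 h.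
rewrite normrM normfV [`|cone_den _ _|]ger0_norm ?(ltW h) // ler_pdivrMr //.
rewrite !normrM norm_conjC normr_nat.
rewrite -(@ler_pM2l _ 2%:R) ?ltr0n // mulVKf ?pnatr_eq0 //.
apply: le_trans (cone_den_ge s t).
by rewrite le_eqVlt; apply/orP; left; apply/eqP; ring.
Qed.

Lemma cone_ratioE s t : s != 0 -> 2%:R * `|t| <= `|s| -> cone_ratio s t = t / s.
Proof.
move=> s0 ts; rewrite /cone_ratio /cone_den [`|_ - _|]ger0_norm; last first.
  have -> : 4%:R * `|t| ^+ 2 = (2%:R * `|t|) ^+ 2 by ring.
  by rewrite subr_ge0 ler_pXn2r // nnegrE ?mulr_ge0 ?ler0n.
have -> : `|s| ^+ 2 + 4%:R * `|t| ^+ 2 + (`|s| ^+ 2 - 4%:R * `|t| ^+ 2) =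
  2%:R * (s * s^*) by rewrite -normCK; ring.
by field; rewrite fmorph_eq0 s0.
Qed.

Lemma norm_cone_ratioX m s t : (0 < m)%N -> `|cone_ratio s t ^+ m| <= 2%:R^-1.
Proof.
case: m => // m _; rewrite exprS normrM normrX -[leRHS]mulr1.
rewrite ler_pM ?exprn_ge0 ?norm_cone_ratio // exprn_ile1 //.
by apply: le_trans (norm_cone_ratio s t) _; rewrite invf_le1 ?ler1n ?ltr0n.
Qed.

Lemma norm_twist_le m s t : `|twist m s t| <= 2%:R.
Proof.
rewrite normrN; apply: le_trans (ler_normD _ _) _.
rewrite normr1 -[2%:R]/(1 + 1) lerD2l normrX exprn_ile1 //.
by apply: le_trans (norm_cone_ratio s t) _; rewrite invf_le1 ?ler1n ?ltr0n.
Qed.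

Lemma norm_twist_ge m s t : 2%:R^-1 <= `|twist m s t|.
Proof.
(* For m = 0 the twist is the constant -2; otherwise the power has modulus at most 1/2. *)
rewrite normrN; case: m => [|m].
  rewrite expr0 -[1 + 1]/(2%:R) normr_nat.
  by apply: (@le_trans _ _ 1); rewrite ?invf_le1 ?ler1n ?ltr0n.
have h := norm_cone_ratioX s t (ltn0Sn m).
rewrite -[cone_ratio s t ^+ _]opprK.
apply: le_trans (lerB_dist _ _); rewrite normr1 normrN.
rewrite lerBrDr; apply: le_trans (lerD (lexx _) h) _.
by rewrite le_eqVlt; apply/orP; left; apply/eqP; field.
Qed.

Lemma twist_neq0 m s t : twist m s t != 0.
Proof.
rewrite -normr_gt0; apply: lt_le_trans (norm_twist_ge m s t).
by rewrite invr_gt0 ltr0n.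
Qed.

Lemma twist_scale m c s t : c != 0 -> twist m (c * s) (c * t) = twist m s t.
Proof. by move=> c0; rewrite /twist cone_ratio_scale. Qed.

Lemma continuous_conjC : continuous (fun x : K => x^*).
Proof.
move=> x; apply/(@cvgrPdist_lt K K) => e e0; exists e => // y.
by rewrite /= -rmorphB norm_conjC.
Qed.

Definition twist_map m w : K * K :=
  (twist m w.1 w.2 * w.2, twist m w.1 w.2 * w.1).

(** The twist is constant on each line through the origin, so it can be recovered from the image
    point after undoing the swap of coordinates. *)
Definition twist_inv m w : K * K :=
  ((twist m w.2 w.1)^-1 * w.2, (twist m w.2 w.1)^-1 * w.1).

(** * Continuity of the twist and of its inverse *)

Section Limits.
Context {T : Type} (F : set_system T) {FF : Filter F}.

Lemma exprn_cvg n (f : T -> K) (a : K) :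
  f x @[x --> F] --> a -> (f x ^+ n) @[x --> F] --> a ^+ n.
Proof.
move=> fa; elim: n => [|n IHn]; first exact: cvg_cst.
rewrite exprS; under eq_fun do rewrite exprS.
exact: cvgM.
Qed.

Lemma twist_cvg m (f g : T -> K) (a b : K) :
  f x @[x --> F] --> a -> g x @[x --> F] --> b -> (a != 0) || (b != 0) ->
  twist m (f x) (g x) @[x --> F] --> twist m a b.
Proof.
move=> fa gb ab; apply: cvgN; apply: cvgD; first exact: cvg_cst.
apply: exprn_cvg; apply: cvgM.
  apply: cvgM => //; apply: cvgM; first exact: cvg_cst.
  exact: (continuous_cvg _ (@continuous_conjC a) fa).
have norm2 (u : T -> K) (c : K) : u x @[x --> F] --> c ->
    (`|u x| ^+ 2) @[x --> F] --> `|c| ^+ 2.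
  by move=> uc; apply: exprn_cvg; exact: cvg_norm.
have g4 : (4%:R * `|g x| ^+ 2) @[x --> F] --> 4%:R * `|b| ^+ 2.
  by apply: cvgM; [exact: cvg_cst | exact: norm2].
apply: cvgV; first by rewrite gt_eqF ?cone_den_gt0.
apply: cvgD; first by apply: cvgD => //; exact: norm2.
by apply: cvg_norm; apply: cvgB => //; exact: norm2.
Qed.

(** Serves at the origin, where the twist need not have a limit but stays bounded, as does its
    inverse. *)
Lemma bounded_mul_cvg0 (u f : T -> K) (C : K) :
  (forall x, `|u x| <= C) -> f x @[x --> F] --> (0 : K) ->
  u x * f x @[x --> F] --> (0 : K).
Proof.
move=> uC f0; apply/(@cvgr0Pnorm_lt K K _ _ FF) => e e0.
have C1 : 0 < `|C| + 1 by rewrite ltr_wpDl.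
have := proj1 (@cvgr0Pnorm_lt K K _ _ FF f) f0 (e / (`|C| + 1)) (divr_gt0 e0 C1).
apply: filterS => x; rewrite ltr_pdivlMr // => h; rewrite normrM.
apply: le_lt_trans h; rewrite mulrC ler_wpM2l //.
apply: le_trans (uC x) _; rewrite ger0_norm ?lerDl //.
exact: le_trans (uC x).
Qed.

Lemma twist_map_cvg m (f g : T -> K) (a b : K) :
  f x @[x --> F] --> a -> g x @[x --> F] --> b ->
  twist_map m (f x, g x) @[x --> F] --> twist_map m (a, b).
Proof.
move=> fa gb; have [ab0|] := boolP ((a != 0) || (b != 0)).
  have c := twist_cvg (m := m) fa gb ab0.
  exact: (@cvg_pair _ _ _ _ _ _ _ _ _ _ _ (cvgM c gb) (cvgM c fa)).
move=> /norP[/negPn/eqP a0 /negPn/eqP b0]; subst a b.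
have bd x := norm_twist_le m (f x) (g x).
rewrite /twist_map /= !mulr0.
exact: (@cvg_pair _ _ _ _ _ _ _ _ _ _ _
  (bounded_mul_cvg0 bd gb) (bounded_mul_cvg0 bd fa)).
Qed.

Lemma twist_inv_cvg m (f g : T -> K) (a b : K) :
  f x @[x --> F] --> a -> g x @[x --> F] --> b ->
  twist_inv m (f x, g x) @[x --> F] --> twist_inv m (a, b).
Proof.
move=> fa gb; have [ba0|] := boolP ((b != 0) || (a != 0)).
  have c : (twist m (g x) (f x))^-1 @[x --> F] --> (twist m b a)^-1.
    by apply: cvgV; [exact: twist_neq0 | exact: twist_cvg].
  exact: (@cvg_pair _ _ _ _ _ _ _ _ _ _ _ (cvgM c gb) (cvgM c fa)).
move=> /norP[/negPn/eqP b0 /negPn/eqP a0]; subst a b.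
have bd x : `|(twist m (g x) (f x))^-1| <= 2%:R.
  rewrite normfV -[leRHS]invrK lef_pV2 ?norm_twist_ge // posrE.
    by rewrite normr_gt0 twist_neq0.
  by rewrite invr_gt0 ltr0n.
rewrite /twist_inv /= !mulr0.
exact: (@cvg_pair _ _ _ _ _ _ _ _ _ _ _
  (bounded_mul_cvg0 bd gb) (bounded_mul_cvg0 bd fa)).
Qed.

End Limits.

Lemma twist_mapK m : cancel (twist_map m) (twist_inv m).
Proof.
move=> [s t]; rewrite /twist_inv /= twist_scale ?twist_neq0 //.
by rewrite !mulKf ?twist_neq0.
Qed.

Lemma twist_invK m : cancel (twist_inv m) (twist_map m).
Proof.
move=> [s t]; rewrite /twist_map /= twist_scale ?invr_eq0 ?twist_neq0 //.
by rewrite !mulVKf ?twist_neq0.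
Qed.

Lemma twist_map_continuous m : continuous (twist_map m).
Proof.
case=> s t; apply: (@twist_map_cvg _ _ (nbhs_filter2 (s, t)) m fst snd).
  exact: cvg_fst.
exact: cvg_snd.
Qed.

Lemma twist_inv_continuous m : continuous (twist_inv m).
Proof.
case=> u v; apply: (@twist_inv_cvg _ _ (nbhs_filter2 (u, v)) m fst snd).
  exact: cvg_fst.
exact: cvg_snd.
Qed.

(* With [phi = - (1 + (t / s) ^+ m)] the substitution [(u, v) = (phi t, phi s)]
   gives [u ^+ n - v ^+ n.+1 = phi ^+ n * (t ^+ n + s ^+ n.+1 + s ^+ (n.+1 - m) t ^+ m)]. *)
Lemma twist_map_eq m n s t : (m <= n.+1)%N -> (0 < n)%N ->
    2%:R * `|t| <= `|s| ->
  ((twist_map m (s, t)).1 ^+ n == (twist_map m (s, t)).2 ^+ n.+1) =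
  (s ^+ n.+1 + s ^+ (n.+1 - m) * t ^+ m + t ^+ n == 0).
Proof.
move=> mn; have [->|s0 n0 ts] := eqVneq s 0.
  (* On the line s = 0 the cone contains only the origin, which satisfies both equations. *)
  rewrite normr0 pmulr_rle0 ?ltr0n // normr_le0 => n0 /eqP ->.
  by rewrite /= !mulr0 -exprD subnK // !expr0n /= gtn_eqF // !addr0 !eqxx.
rewrite /= -[LHS]subr_eq0.
have -> : (twist m s t * t) ^+ n - (twist m s t * s) ^+ n.+1 =
    twist m s t ^+ n * (s ^+ n.+1 + s ^+ (n.+1 - m) * t ^+ m + t ^+ n).
  rewrite !exprMn exprSr -mulrA -mulrBr; congr (_ * _).
  have -> : s ^+ (n.+1 - m) * t ^+ m = s ^+ n.+1 * (t / s) ^+ m.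
    by rewrite -{2}(subnK mn) exprD expr_div_n -mulrA [s ^+ m * _]mulrC divfK // expf_neq0.
  by rewrite /twist cone_ratioE //; ring.
by rewrite mulf_eq0 expf_eq0 (negPf (twist_neq0 _ _ _)) andbF.
Qed.

(** Cancelling phi^n leaves t^n = phi s^(n+1), where |phi| <= 2 and |s| <= 2 |t|. *)
Lemma steep_twist_bound m n s t : `|s| < 2%:R * `|t| ->
  (twist_map m (s, t)).1 ^+ n = (twist_map m (s, t)).2 ^+ n.+1 ->
  `|t| ^+ n <= 2%:R ^+ n.+2 * `|t| ^+ n.+1.
Proof.
move=> /ltW st /= e.
have -> : `|t| ^+ n = `|twist m s t| * `|s| ^+ n.+1.
  rewrite -!normrX -normrM; congr `|_|.
  apply: (mulfI (expf_neq0 n (twist_neq0 m s t))).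
  by rewrite -exprMn e exprMn mulrA -exprSr.
rewrite [2%:R ^+ _]exprS -mulrA -exprMn.
by rewrite ler_pM ?exprn_ge0 ?norm_twist_le ?lerXn2r ?nnegrE ?mulr_ge0 ?ler0n.
Qed.

(** Each of the two terms other than t^n has modulus at most (2 |t|)^(n+1). *)
Lemma steep_curve_bound m n s t : (m <= n.+1)%N -> `|s| < 2%:R * `|t| ->
  s ^+ n.+1 + s ^+ (n.+1 - m) * t ^+ m + t ^+ n = 0 ->
  `|t| ^+ n <= 2%:R ^+ n.+2 * `|t| ^+ n.+1.
Proof.
move=> mn /ltW st /eqP; rewrite addrC addr_eq0 -normrX => /eqP ->.
rewrite normrN; apply: le_trans (ler_normD _ _) _.
have t2 : 0 <= 2%:R * `|t| by rewrite mulr_ge0 ?ler0n.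
have tt : `|t| <= 2%:R * `|t| by rewrite mulr_natl mulr2n lerDl.
rewrite [2%:R ^+ _]exprS -mulrA -exprMn [leRHS]mulr_natl mulr2n normrM !normrX.
rewrite lerD ?lerXn2r ?nnegrE // -{2}(subnK mn) exprD.
by rewrite ler_pM ?exprn_ge0 // lerXn2r ?nnegrE.
Qed.

(* Outside the cone [2 |t| <= |s|] neither curve has points near the origin. *)
Lemma top_equiv_cuspidal_germ m n (F : set (K * K)) :
  (0 < n)%N -> (m <= n.+1)%N ->
  (forall w, F w <-> w.1 ^+ n.+1 + w.1 ^+ (n.+1 - m) * w.2 ^+ m + w.2 ^+ n = 0) ->
  top_equiv_germs F [set w : K * K | w.1 ^+ n = w.2 ^+ n.+1].
Proof.
move=> n0 mn FE.
have p2 : 0 < 2%:R ^+ n.+2 :> K by rewrite exprn_gt0 ?ltr0n.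
(* In this strip 2^(n+2) |t| < 1, which contradicts the steep bounds as soon as t is nonzero. *)
pose U : set (K * K) := snd @^-1` (ball (0 : K) (2%:R ^+ n.+2)^-1).
have oU : open U.
  apply: open_comp; last exact: (@ball_open K K).
  by case=> s t _; exact: cvg_snd.
have UE w : U w -> 2%:R ^+ n.+2 * `|w.2| < 1.
  by rewrite /U /preimage -ball_normE /= sub0r normrN -ltr_pdivlMl // mulr1.
have flat s t : U (s, t) -> `|s| < 2%:R * `|t| ->
    ~ `|t| ^+ n <= 2%:R ^+ n.+2 * `|t| ^+ n.+1.
  move=> /UE /= Ust st.
  have t0 : 0 < `|t| by rewrite -(@pmulr_rgt0 _ 2%:R) ?ltr0n // (le_lt_trans _ st).
  rewrite [`|t| ^+ n.+1]exprS mulrA -{1}[_ ^+ n]mul1r ler_pM2r ?exprn_gt0 // => /le_lt_trans /(_ Ust).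
  by rewrite ltxx.
have key w : U w -> F w <-> (twist_map m w).1 ^+ n = (twist_map m w).2 ^+ n.+1.
  case: w => s t Ust; have [st|st] := real_leP (realM (realn K 2) (normr_real t)) (normr_real s).
    split=> [/FE/eqP|/eqP].
      by rewrite -twist_map_eq // => /eqP.
    by rewrite (twist_map_eq mn n0 st) => /eqP h; apply/FE.
  split=> [/FE /= h|h]; exfalso; apply: (flat _ _ Ust st).
    exact: steep_curve_bound h.
  exact: steep_twist_bound h.
have U0 : U (0, 0) by apply: ballxx; rewrite invr_gt0.
have h0 : twist_map m (0, 0) = (0, 0) by rewrite /twist_map /= !mulr0.
exists U, (twist_inv m @^-1` U), (twist_map m), (twist_inv m); split => //.
- split; split => //.
    by apply: open_comp => // w _; exact: twist_inv_continuous.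
  by rewrite /preimage /= -h0 twist_mapK.
- split; apply: continuous_subspaceT; first exact: twist_map_continuous.
  exact: twist_inv_continuous.
- split=> w; first by move=> Uw; rewrite /preimage /= twist_mapK.
  by rewrite /preimage /= => Uw; rewrite twist_invK.
- apply/seteqP; split=> [_ [w [Fw Uw] <-]|w [Bw Uw]].
    by split; [apply/key | rewrite /preimage /= twist_mapK].
  exists (twist_inv m w); last exact: twist_invK.
  by split => //; apply/key => //; rewrite twist_invK.
Qed.
End ConicalTwist.

(** * The curve *)

Section Curve.
Variable K : numFieldType.

Local Notation S := {mpoly K[3]}.
Local Notation x := ('X_(0 : 'I_3) : S).
Local Notation y := ('X_(1 : 'I_3) : S).
Local Notation z := ('X_(2 : 'I_3) : S).
Local Notation s := ('X_(0 : 'I_2) : {mpoly K[2]}).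
Local Notation t := ('X_(1 : 'I_2) : {mpoly K[2]}).

Lemma forall_I2 (P : 'I_2 -> Prop) : P 0 -> P 1 -> forall i, P i.
Proof.
move=> P0 P1 [[|[|//]] i2].
- by rewrite (_ : Ordinal i2 = 0) //; apply: val_inj.
- by rewrite (_ : Ordinal i2 = 1) //; apply: val_inj.
Qed.

Lemma tnth2_0 (A : Type) (a b : A) : tnth [tuple a; b] 0 = a.
Proof. by []. Qed.

Lemma tnth2_1 (A : Type) (a b : A) : tnth [tuple a; b] 1 = b.
Proof. by []. Qed.

Definition tnth2E := (tnth2_0, tnth2_1).

Section Composition.
Variables (m n : nat) (l : m.-tuple {mpoly K[n]}).
Implicit Types (p q : {mpoly K[m]}).

Lemma comp_mpolyM p q : (p * q) \mPo l = (p \mPo l) * (q \mPo l).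
Proof. exact: rmorphM. Qed.

Lemma comp_mpolyXn p k : (p ^+ k) \mPo l = (p \mPo l) ^+ k.
Proof. exact: rmorphXn. Qed.

Lemma comp_mpoly_var i : 'X_i \mPo l = tnth l i.
Proof. by rewrite comp_mpolyXU -tnth_nth. Qed.

Definition compE :=
  (comp_mpolyD, comp_mpolyB, comp_mpolyN, comp_mpolyM, comp_mpolyXn, comp_mpoly_var).
End Composition.

Variables d d1 d2 : nat.
Hypotheses (hd1 : (1 <= d1)%N) (hd : (2 * d1 <= d)%N) (hd2 : d2 = (d - d1)%N).

Local Notation f := (curve_eq K d d1 d2).

Let P : S := x ^+ d + x ^+ (d2 + 1) * y ^+ (d1 - 1).

Lemma curveE : f = P + y ^+ (d - 1) * z.
Proof. by []. Qed.

Lemma curve_homog : f \is d.-homog.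
Proof. rewrite curveE /P; homog_auto. Qed.

Lemma curve_neq0 : f != 0.
Proof.
have [_ _ f2] := curve_deriv K d d1 d2.
apply/eqP => f0; move: f2; rewrite f0 mderiv0 => /esym/eqP.
by rewrite expf_eq0 (negPf (X_neq0 _ 1)) andbF.
Qed.

Lemma subst0y_P_neq0 : subst0 1 P != 0.
Proof.
have xd0 : x ^+ d != 0 by rewrite expf_neq0 ?X_neq0.
rewrite /P subst0D subst0M !subst0y_x.
(* For d1 = 1 the two monomials add up to 2 x^d; otherwise the second one vanishes modulo y. *)
have [d11|d1_neq1] := eqVneq d1 1%N.
  have -> : (d2 + 1)%N = d by rewrite hd2 d11; move: hd; rewrite d11; clear; lia.
  rewrite d11 subnn expr0 /subst0 comp_mpoly1 mulr1 -mulr2n -mulr_natl.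
  by rewrite mulf_neq0 // -mpolyC_nat mpolyC_neq0 // pnatr_eq0.
rewrite subst0y_y ?mulr0 ?addr0 //.
by move: hd1 d1_neq1; clear; lia.
Qed.

Lemma curve_irreducible : irreducible_elt f.
Proof.
split; first exact: curve_neq0.
  (* A unit vanishes nowhere, but f vanishes at (0 : 0 : 1). *)
  apply/negP => /unitrP [q [/(congr1 (meval (fun i : 'I_3 => (i == 2)%:R)))]].
  rewrite mevalM meval1 curveE /P !mevalRE /= => /eqP.
  rewrite !expr0n !addn1 (_ : (d == 0)%N = false); last by move: hd hd1; clear; lia.
  rewrite (_ : (d - 1 == 0)%N = false); last by move: hd hd1; clear; lia.
  by rewrite !mul0r !addr0 mulr0 eq_sym oner_eq0.
rewrite curveE; apply: irreducible_linear => //; last exact: subst0y_P_neq0.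
rewrite /P /univar !(mmapD, rmorphM, rmorphXn) /= -!/(univar _ _) !univarX /=.
by rewrite polyCD polyCM !polyC_exp.
Qed.

Lemma curve_reduced : reduced_curve d f.
Proof.
split; [by move: hd hd1; clear; lia | exact: curve_neq0 | exact: curve_homog |].
exact: irreducible_squarefree curve_irreducible.
Qed.

Lemma curve_nearly_free : nearly_free d d1 d2 f.
Proof.
split; [exact: curve_reduced | by lia | by lia |].
exact: curve_minimally_generated.
Qed.

(** * Rational parametrization *)

Let param : 3.-tuple {mpoly K[2]} :=
  [tuple s * t ^+ (d - 1); t ^+ d; - (s ^+ d + s ^+ (d2 + 1) * t ^+ (d1 - 1))].
Let proj : 2.-tuple S := [tuple x; y].

(** Lines through (0 : 0 : 1) give [param]: put (x : y) = (s : t), solve f = 0 for z and clear the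
    denominator t^(d-1). The inverse map [proj] is the projection from that point. *)
Lemma curve_param : f \mPo param = 0.
Proof.
rewrite curveE /P !compE /param !tnth3E !exprMn (exprAC t (d - 1)) -mulrA.
(* Both exponents equal d (d - 1) + d1 - 1. *)
rewrite (_ : (t ^+ (d - 1)) ^+ (d2 + 1) * _ = (t ^+ d) ^+ (d - 1) * t ^+ (d1 - 1)).
  by move: (s ^+ d) (s ^+ (d2 + 1)) ((t ^+ d) ^+ _) (t ^+ (d1 - 1)) => s1 s2 t1 t2; ring.
rewrite -!exprM -!exprD; congr (_ ^+ _).
case: d1 hd1 hd hd2 => // m _ hm ->.
have -> : d = (m.+1 + (d - m.+1))%N by lia.
by move: (d - m.+1)%N => n; rewrite !addKn !subn1 addn1 /=; ring.
Qed.

Lemma neq0_not_divides (p : S) : p \mPo param != 0 -> ~ divides f p.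
Proof. by move=> p0 [h ph]; move: p0; rewrite ph comp_mpolyM curve_param mulr0 eqxx. Qed.

Lemma curve_birational : birational_to_P1 f.
Proof.
have t0 : t != 0 :> {mpoly K[2]} by exact: mpolyX_neq0.
have dS : (0 < d)%N by move: hd1 hd; clear; lia.
have dE : t ^+ d = t ^+ (d - 1) * t by rewrite -exprSr subn1 prednK.
exists d, 1%N, param, proj; split.
- split.
    by apply: forall_I3; rewrite /param tnth3E; homog_auto.
  by apply: forall_I2; rewrite /proj tnth2E; homog_auto.
- split; last exact: curve_param.
  by exists 1; rewrite /param tnth3E expf_neq0.
- exists 1; apply: neq0_not_divides.
  by rewrite /proj tnth2E comp_mpoly_var /param tnth3E expf_neq0.
- split; first by exists 1; rewrite /proj tnth2E comp_mpoly_var /param tnth3E expf_neq0.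
  have compE j : tnth proj j \mPo param = 'X_j * t ^+ (d - 1).
    move: j; apply: forall_I2; rewrite /proj tnth2E comp_mpoly_var /param tnth3E //.
    by rewrite dE mulrC.
  by move=> i j; rewrite !compE mulrCA.
(* The composite is y^(d-1) times the identity, except that the third coordinate is corrected by a
   multiple of f. *)
have paramE j : tnth param j \mPo proj = 'X_j * y ^+ (d - 1) - (j == 2)%:R * f.
  move: j; apply: forall_I3; rewrite /param tnth3E !compE /proj !tnth2E /=.
  - by rewrite mul0r subr0.
  - by rewrite mul0r subr0 mulrC -exprSr subn1 prednK.
  - by rewrite mul1r curveE -/P [y ^+ _ * z]mulrC [in RHS]opprD addrCA subrr addr0.
split.
  exists 1; rewrite /param tnth3E !compE /proj tnth2E.
  by apply: neq0_not_divides; rewrite !compE /param tnth3E !expf_neq0.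
move=> i j; exists ('X_j * (i == 2)%:R - 'X_i * (j == 2)%:R).
rewrite !paramE; move: (y ^+ _) ((i == 2)%:R : S) ((j == 2)%:R : S) => q r1 r2.
by ring.
Qed.

(** * The cusp *)

Definition cusp : 'rV[K]_3 := row3 0 0 1.

(** For d = 2 the curve is the smooth conic 2 x^2 + y z = 0. *)
Hypothesis d_gt2 : (2 < d)%N.

Let d2_gt0 : (0 < d2)%N. Proof. by move: hd1 hd hd2 d_gt2; clear; lia. Qed.

Lemma cusp_singular : singular_at f cusp.
Proof.
have [f0 f1 f2] := curve_deriv K d d1 d2.
have [n dE] : exists n, d = n.+3 by exists (d - 3)%N; move: d_gt2; clear; lia.
have [m d2E] : exists m, d2 = m.+1 by exists d2.-1; move: d2_gt0; clear; lia.
split; last apply: forall_I3; rewrite ?f0 ?f1 ?f2 ?curveE /P !mevalRE ?mevalMn ?mevalXn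
  ?mevalXU /cusp !row3E ?dE ?d2E ?subSS ?subn0 ?addn1 /= !expr0n /=;
  by rewrite ?(mul0r, mul0rn, mulr0, addr0).
Qed.

(** The derivative in z forces y = 0; the derivative in x then becomes a nonzero multiple of
    x^(d-1), to which both terms contribute when d1 = 1. *)
Lemma cusp_unique (w : 'rV[K]_3) : w != 0 -> singular_at f w ->
  exists c : K, c != 0 /\ w = c *: cusp.
Proof.
move=> w0 [_ sing]; have [f0 f1 f2] := curve_deriv K d d1 d2.
have w1 : w 0 1 = 0.
  have := sing 2; rewrite f2 mevalXn mevalXU => /eqP.
  by rewrite expf_eq0 => /andP[_ /eqP].
have x0 : w 0 0 = 0.
  have := sing 0; rewrite f0 mevalD mevalM !mevalMn !mevalXn !mevalXU w1.
  have [d11|d1_neq1] := eqVneq d1 1%N.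
    have -> : d2 = d.-1 by rewrite hd2 d11 subn1.
    rewrite d11 subnn expr0 mulr1 -mulrnDr => /eqP.
    rewrite mulrn_eq0 expf_eq0 => /orP[|/andP[_ /eqP //]].
    by rewrite addn_eq0; move: d_gt2; clear; lia.
  have -> : (d1 - 1)%N = (d1 - 2).+1 by move: hd1 d1_neq1; clear; lia.
  rewrite exprS mul0r mulr0 addr0 => /eqP.
  rewrite mulrn_eq0 expf_eq0 => /orP[|/andP[_ /eqP //]].
  by move: d_gt2; clear; lia.
exists (w 0 2); have wE : w = w 0 2 *: cusp.
  by apply/rowP; apply: forall_I3; rewrite mxE /cusp row3E ?mulr0 ?mulr1.
by split=> //; apply: contra_neq w0 => w2; rewrite wE w2 scale0r.
Qed.

Lemma cusp_chart (i : 'I_3) : cusp 0 i != 0 -> i = 2.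
Proof. by move: i; apply: forall_I3; rewrite /cusp row3E ?eqxx. Qed.

Lemma local_eq_cusp :
  local_eq f cusp 2 = s ^+ d + s ^+ (d2 + 1) * t ^+ (d1 - 1) + t ^+ (d - 1).
Proof.
have e0 : unlift (2 : 'I_3) 0 = Some (0 : 'I_2).
  by rewrite (_ : 0 = lift 2 (0 : 'I_2)) ?liftK //; apply: val_inj.
have e1 : unlift (2 : 'I_3) 1 = Some (1 : 'I_2).
  by rewrite (_ : 1 = lift 2 (1 : 'I_2)) ?liftK //; apply: val_inj.
rewrite /local_eq curveE /P !compE !tnth_mktuple e0 e1 unlift_none /cusp !row3E.
by rewrite mpolyC0 mpolyC1 !add0r addr0 mulr1.
Qed.

Lemma mcoeff_monomial2 (a b i j : nat) :
  (s ^+ a * t ^+ b)@_[multinom [tuple i; j]] = ((a == i) && (b == j))%:R.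
Proof.
have -> : s ^+ a * t ^+ b = 'X_[ [multinom [tuple a; b]] ].
  rewrite [RHS]mpolyXE_id !big_ord_recl big_ord0 mulr1.
  rewrite (_ : lift ord0 ord0 = 1); last exact: val_inj.
  by rewrite !multinomE.
rewrite mcoeffX; congr (_%:R); congr nat_of_bool.
apply/eqP/andP => [e|[/eqP -> /eqP ->] //].
have := congr1 (fun m : 'X_{1..2} => m 0) e; have := congr1 (fun m : 'X_{1..2} => m 1) e.
by rewrite !multinomE !tnth2E => -> ->.
Qed.

Lemma cusp_series i j : series_of_mpoly (local_eq f cusp 2) i j =
  ((d == i) && (0%N == j))%:R + (((d2 + 1)%N == i) && ((d1 - 1)%N == j))%:R +
  ((0%N == i) && ((d - 1)%N == j))%:R.
Proof.
rewrite /series_of_mpoly local_eq_cusp !mcoeffD mcoeff_monomial2.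
rewrite -[s ^+ d]mulr1 -[X in X@__]/(s ^+ d * t ^+ 0).
rewrite -[t ^+ (d - 1)]mul1r -[X in _ + X@__]/(s ^+ 0 * t ^+ (d - 1)).
by rewrite !mcoeff_monomial2.
Qed.

(** For the weight (d - 1) i + d j the pure powers weigh d (d - 1), and the middle monomial weighs
    d1 - 1 more. *)
Lemma cusp_unibranch : unibranch_at f cusp.
Proof.
move=> i /cusp_chart ->.
have dS : (0 < d)%N by move: d_gt2; clear; lia.
apply: (@irreducible_series_segment _ d (d - 1)) => //.
- by rewrite subn_gt0; move: d_gt2; clear; lia.
- by rewrite subn1 coprime_sym coprimePn.
- apply: (@finite_support_convergent _ _ (d + d + d)) => k l kl; rewrite cusp_series.
  rewrite (_ : _ && _ = false); last by move: kl dS; clear; lia.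
  rewrite (_ : _ && _ = false); last by move: kl dS hd1 hd hd2; clear; lia.
  rewrite (_ : _ && _ = false); last by move: kl dS; clear; lia.
  by rewrite !addr0.
- move=> k l; rewrite cusp_series => kl.
  have [/andP[/eqP <- /eqP <-]|n1] := boolP ((d == k) && (0%N == l)).
    by rewrite muln0 addn0 mulnC.
  have [/andP[/eqP <- /eqP <-]|n2] := boolP (((d2 + 1)%N == k) && ((d1 - 1)%N == l)).
    case: d1 hd1 hd hd2 => // m _ hm ->; move: hm.
    move=> hm; have -> : d = (m.+1 + (d - m.+1))%N by lia.
    by move: (d - m.+1)%N => r; rewrite !addKn !subn1 /=; nia.
  have [/andP[/eqP <- /eqP <-]|n3] := boolP ((0%N == k) && ((d - 1)%N == l)).
    by rewrite muln0.
  by move: kl; rewrite (negPf n1) (negPf n2) (negPf n3) !addr0 eqxx.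
(* The coefficient of s^d is 1, or 2 when d1 = 1 makes the middle monomial coincide with it. *)
- rewrite cusp_series !eqxx /= -!natrD pnatr_eq0.
  by clear.
- rewrite cusp_series !eqxx /= -!natrD pnatr_eq0 addn_eq0 negb_and orbT //.
Qed.

Lemma cusp_has_unique_cusp : has_unique_cusp_at f cusp.
Proof.
split; [ | exact: cusp_singular | exact: cusp_unique | exact: cusp_unibranch].
by apply/eqP => /rowP /(_ 2); rewrite /cusp row3E mxE => /eqP; rewrite oner_eq0.
Qed.

Lemma cusp_zero_set (w : K * K) : zero_set (local_eq f cusp 2) w <->
  w.1 ^+ d + w.1 ^+ (d2 + 1) * w.2 ^+ (d1 - 1) + w.2 ^+ (d - 1) = 0.
Proof.
by rewrite /zero_set /mkset local_eq_cusp !mevalRE !tnth2E.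
Qed.

End Curve.

Lemma cusp_Puiseux (K : numClosedFieldType) (d d1 d2 : nat) :
  (1 <= d1)%N -> (2 * d1 <= d)%N -> d2 = (d - d1)%N -> (2 < d)%N ->
  unique_Puiseux_pair_at (d - 1) d (curve_eq K d d1 d2) (cusp K).
Proof.
move=> hd1 hd hd2 d_gt2; split.
- by move: d_gt2; clear; lia.
- by rewrite subn1 coprimePn //; move: d_gt2; clear; lia.
move=> i /cusp_chart ->.
have -> : [set w : K * K | w.1 ^+ (d - 1) = w.2 ^+ d] =
    [set w | w.1 ^+ (d - 1) = w.2 ^+ (d - 1).+1].
  by rewrite (_ : (d - 1).+1 = d) //; move: d_gt2; clear; lia.
(* With m = d1 - 1 and n = d - 1 the exponent n + 1 - m equals d2 + 1. *)
apply: (@top_equiv_cuspidal_germ K (d1 - 1)) => [||w].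
- by move: d_gt2; clear; lia.
- by move: hd hd1; clear; lia.
have -> : (d - 1).+1 = d by move: d_gt2; clear; lia.
have -> : (d - (d1 - 1))%N = (d2 + 1)%N by move: hd hd1 hd2; clear; lia.
exact: cusp_zero_set.
Qed.

Theorem theorem3p1 (R : realType) (d d1 d2 : nat)
    (hd1 : (1 <= d1)%N) (hd : (2 * d1 <= d)%N) (hd2 : d2 = (d - d1)%N) :
  let f : {mpoly R[i][3]} := curve_eq R[i] d d1 d2 in
  nearly_free d d1 d2 f /\
  (rational_curve f /\
   ((2 < d)%N ->
    exists v : 'rV[R[i]]_3,
      has_unique_cusp_at f v /\ unique_Puiseux_pair_at (d - 1) d f v)).
Proof.
move=> f; split; first exact: curve_nearly_free.
split; first by split; [exact: curve_irreducible | exact: curve_birational].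
move=> d_gt2; exists (cusp R[i]).
by split; [exact: cusp_has_unique_cusp | exact: cusp_Puiseux].
Qed.
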